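(* Let $F(z)=\sum_{n=0}^\infty c_nz^n$ be analytic on the unit disc $\mathbb{D}$. (i) Suppose the sequence $\{c_n\}_{n\geq0}$ is bounded from below. If $F(z)/(z-1)$ has pseudomeasure boundary behavior at $z=1$, then $\sum_{n=0}^Nc_n=O(1)$. (ii) Suppose that $\liminf_{n\to\infty}c_n\geq0$. If there is a constant $F(1)$ such that $(F(z)-F(1))/(z-1)$ has pseudofunction boundary behavior at $z=1$, then $\sum_{n=0}^\infty c_n$ converges to $F(1)$.
   Context: Fourier transform $\hat\varphi(t)=\int e^{-itx}\varphi(x)\,\mathrm{d}x$. A tempered distribution $g$ is a pseudomeasure if $\hat g\in L^\infty$, a pseudofunction if moreover $\hat g(x)\to0$ as $|x|\to\infty$. An analytic function $H$ on $\mathbb{D}$ has pseudofunction (pseudomeasure) boundary behavior at $e^{i\theta_0}$ if there is an open interval $U\ni\theta_0$ such that $H(re^{i\theta})$ converges in $\mathcal{D}'(U)$ (as distributions in $\theta$) as $r\to1^-$ to a distribution that coincides near each point of $U$ with a pseudofunction (pseudomeasure). *)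

(* Defs.v *)
(* Complex numbers are  R[i]  from
   mathcomp-real-closed, used through the regular-algebra alias  (R[i])^o
   which carries MathComp-Analysis's normed/topological structure. *)
From HB Require Import structures.
From mathcomp Require Import all_boot all_order all_algebra.
From mathcomp Require Import all_classical all_reals all_analysis.
From mathcomp Require Import complex.
Import Order.TTheory GRing.Theory Num.Theory numFieldNormedType.Exports.

Set Implicit Arguments.
Unset Strict Implicit.
Unset Printing Implicit Defensive.

Local Open Scope classical_set_scope.
Local Open Scope ring_scope.

Notation Cx R := ((R[i])^o).

Definition expi {R : realType} (t : R) : Cx R := (cos t +i* sin t)%C.

Definition Cint {R : realType} (f : R -> Cx R) : Cx R :=
  (Rintegral lebesgue_measure setT (fun x => complex.Re (f x : R[i]))
   +i* Rintegral lebesgue_measure setT (fun x => complex.Im (f x : R[i])))%C.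

Definition fourier {R : realType} (phi : R -> Cx R) (t : R) : Cx R :=
  Cint (fun x => expi (- (t * x)) * phi x).

Definition smooth {R : realType} (f : R -> R) : Prop :=
  forall (n : nat) (x : R), derivable (derive1n n f) x 1.

Definition test_fun {R : realType} (a b : R) (phi : R -> Cx R) : Prop :=
  smooth (fun x => complex.Re (phi x : R[i])) /\
  smooth (fun x => complex.Im (phi x : R[i])) /\
  exists a' b' : R, a < a' /\ b' < b /\
    forall x, x < a' \/ b' < x -> phi x = 0.

Definition psum {R : realType} (c : nat -> R) (z : Cx R) : Cx R :=
  limn (series (fun n => ((c n)%:C%C : Cx R) * z ^+ n)).

Definition Linf_fun {R : realType} (G : R -> Cx R) : Prop :=
  measurable_fun setT (fun t => complex.Re (G t : R[i])) /\
  measurable_fun setT (fun t => complex.Im (G t : R[i])) /\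
  exists M : R, forall t, `|G t| <= (M%:C%C : Cx R).

Definition vanishing_Linf_fun {R : realType} (G : R -> Cx R) : Prop :=
  Linf_fun G /\ G t @[t --> +oo] --> 0 /\ G t @[t --> -oo] --> 0.

(* Action on a test function phi of the tempered distribution g whose
   Fourier transform is the function G :
     <g, phi> = (1/2pi) \int G(t) \hat phi(-t) dt
   (Fourier inversion: phi = \hat psi with psi(x) = \hat phi(-x) / 2pi, and
    <g, \hat psi> = <\hat g, psi>). *)
Definition inv_fourier_action {R : realType} (G : R -> Cx R)
    (phi : R -> Cx R) : Cx R :=
  (((2 * pi)^-1 : R)%:C%C : Cx R) * Cint (fun t => G t * fourier phi (- t)).

(* Distributional boundary behaviour of an analytic H on the disc at
   e^{i th0}: there is an open interval U = ]a,b[ containing th0 such that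
   H(r e^{i th}) converges in D'(U) as r -> 1^- to some distribution T, and
   T coincides near every point of U with a tempered distribution g whose
   Fourier transform is a function satisfying  P  (P = L^infinity gives
   pseudomeasures, P = L^infinity vanishing at infinity gives
   pseudofunctions). *)
Definition boundary_behavior {R : realType} (P : (R -> Cx R) -> Prop)
    (H : Cx R -> Cx R) (th0 : R) : Prop :=
  exists a b : R, a < th0 < b /\
  exists T : (R -> Cx R) -> Cx R,
    (forall phi, test_fun a b phi ->
       Cint (fun th => H ((r%:C%C : Cx R) * expi th) * phi th) @[r --> 1^'-]
         --> T phi) /\
    (forall th1, a < th1 < b ->
       exists e : R, 0 < e /\ a <= th1 - e /\ th1 + e <= b /\
       exists G : R -> Cx R, P G /\
         forall phi, test_fun (th1 - e) (th1 + e) phi ->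
           T phi = inv_fourier_action G phi).

Definition pseudomeasure_bb {R : realType} (H : Cx R -> Cx R) (th0 : R) :=
  boundary_behavior Linf_fun H th0.

Definition pseudofunction_bb {R : realType} (H : Cx R -> Cx R) (th0 : R) :=
  boundary_behavior vanishing_Linf_fun H th0.

(* Main.v *)
(* Put s_n = c_0 + ... + c_n - F(1), with F(1) := 0 in part (i). Then
   (F(z) - F(1)) / (z - 1) = - \sum s_n z^n on the disc, so testing the boundary
   behavior against e^{-iNx} phi(x), with phi a test function supported near 0
   whose Fourier transform w is nonnegative with w(0) > 0, shows that
   \sum s_n r^n w(n - N) has a limit beta_N as r -> 1-, and that beta_N is
   bounded (pseudomeasure) or tends to 0 (pseudofunction). Such a phi is the
   autocorrelation of a smooth bump, and w decays like t^-4.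

   Subtracting the sums for consecutive N gives the same control on
   \sum c_n r^n w(n - N). As w >= 0 and c_n is bounded below, a single term of
   this sum is bounded by the whole: c_n is bounded, and c_n -> 0 when
   liminf c_n >= 0. So s_n varies slowly around N, and \sum s_n r^n w(n - N) is
   comparable with s_N \sum r^n w(n - N); hence s_N is bounded, respectively
   tends to 0. *)
Require Import Defs.
From HB Require Import structures.
From mathcomp Require Import all_boot all_order all_algebra.
From mathcomp Require Import all_classical all_reals all_analysis.
From mathcomp Require Import measurable_realfun complex ring lra.
Import Order.TTheory GRing.Theory Num.Theory numFieldNormedType.Exports.
Set Implicit Arguments.
Unset Strict Implicit.
Unset Printing Implicit Defensive.
Local Open Scope classical_set_scope.
Local Open Scope ring_scope.

(** * Smooth functions *)

(** The weight 1 + (n - N)^2 holds the argument together. Decay of order t^-4 keeps it summable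
    against w(n - N), uniformly in N, so a defect of size eta (1 + (n - N)^2), whether a negative
    part of the increments or a deviation of s_n from s_N, costs at most a constant times eta. A
    defect that is small only from some index on fits in as well: for the finitely many earlier n, a
    crude bound falls below eta (n - N)^2 once N is far away.

    Convergence of the sums at r = 1 is not known beforehand. Every inequality is therefore proved
    on partial sums for r < 1 with constants free of r, and the passage to r = 1 happens at fixed N,
    before N grows.

    The coefficients are real but F(1) may be complex. The sequence argument is stated for real
    sequences and run twice in part (ii); on imaginary parts all increments vanish, and it yields Im
    F(1) = 0.

    Autocorrelation is what gives positivity: its transform is the squared modulus of the transform
    of the bump. *)

Section Smooth.
Context {R : realType}.
Implicit Types (f g : R -> R) (a b x : R).

(** [smooth] quantifies over all iterated derivatives; a class of differentiable functions closed
    under derivation avoids computing them. The smoothness proofs below exhibit such a class or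
    combine earlier ones. *)
Lemma smooth_coind (P : (R -> R) -> Prop) :
  (forall f, P f -> (forall x, derivable f x 1) /\ P (f^`()%classic)) ->
  forall f, P f -> smooth f.
Proof.
move=> H f Pf n; suff: P (derive1n n f) by move=> /H[].
by elim: n f Pf => // n IH f Pf; rewrite derive1nS; apply: (H _ (IH _ Pf)).2.
Qed.

Lemma smooth_derivable f x : smooth f -> derivable f x 1.
Proof. exact: (fun h => h 0%N x). Qed.

Lemma smooth_derive1 f : smooth f -> smooth (f^`()%classic).
Proof. by move=> sf n x; rewrite -derive1Sn; apply: sf. Qed.

Lemma smooth_continuous f : smooth f -> continuous f.
Proof.
by move=> sf x; apply: differentiable_continuous; apply/derivable1_diffP; exact: smooth_derivable.
Qed.

Lemma smooth_is_derive f x : smooth f -> is_derive x 1 f (f^`()%classic x).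
Proof. by move=> sf; apply: DeriveDef; [exact: smooth_derivable|rewrite derive1E]. Qed.

Lemma is_derive1E f (df : R -> R) :
  (forall x, is_derive x 1 f (df x)) -> (forall x, derivable f x 1) /\ f^`()%classic = df.
Proof.
move=> H; split=> [x|]; first by case: (H x).
by apply/funext => x; rewrite derive1E; case: (H x).
Qed.

(* Sums of products of smooth functions are stable under differentiation. *)
Inductive smooth_products : (R -> R) -> Prop :=
| smooth_product f g : smooth f -> smooth g -> smooth_products (fun x => f x * g x)
| smooth_products_add f g : smooth_products f -> smooth_products g ->
    smooth_products (fun x => f x + g x).

Lemma smooth_products_smooth f : smooth_products f -> smooth f.
Proof.
apply: smooth_coind => {}f; elim=> [{}f g sf sg|{}f g _ [df pf] _ [dg pg]].
  have [|? ->] := @is_derive1E (fun x => f x * g x)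
    (fun x => (f x * g^`()%classic x) + (g x * f^`()%classic x)).
    move=> x; have ? := smooth_is_derive x sf; have ? := smooth_is_derive x sg.
    exact: is_deriveM.
  split; first by [].
  exact: (smooth_products_add (smooth_product sf (smooth_derive1 sg))
            (smooth_product sg (smooth_derive1 sf))).
have [|? ->] := @is_derive1E (fun x => f x + g x) (fun x => f^`()%classic x + g^`()%classic x).
  move=> x; have E (h : R -> R) : derivable h x 1 -> is_derive x 1 h (h^`()%classic x).
    by move=> dh; apply: DeriveDef; [|rewrite derive1E].
  exact: (is_deriveD (E _ (df x)) (E _ (dg x))).
by split; [|exact: (smooth_products_add pf pg)].
Qed.

Lemma smoothM f g : smooth f -> smooth g -> smooth (fun x => f x * g x).
Proof. by move=> ? ?; apply/smooth_products_smooth/smooth_product. Qed.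

Lemma smooth_cst a : smooth (fun=> a).
Proof.
apply: (@smooth_coind (fun f => exists b, f = fun=> b)); last by exists a.
move=> _ [b ->]; have D x : is_derive x 1 (fun=> b) (0 : R) by apply: is_derive_cst.
by have [? ->] := is_derive1E D; split=> //; exists 0.
Qed.

Lemma smooth_affine f a b : smooth f -> smooth (fun x => f (a + b * x)).
Proof.
move=> sf; suff: smooth (fun x => 1 * f (a + b * x)).
  by congr smooth; apply/funext => x; rewrite mul1r.
(* The scalar [k] collects the powers of [b] produced by the chain rule. *)
apply: (@smooth_coind (fun h => exists k g, smooth g /\ h = fun x => k * g (a + b * x))); last first.
  by exists 1, f.
move=> _ [k [g [sg ->]]].
have D x : is_derive x 1 (fun x => k * g (a + b * x)) (k * b * g^`()%classic (a + b * x)).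
  have Da : is_derive x 1 (fun x => a + b * x) b.
    have := is_deriveD (is_derive_cst a x 1) (is_deriveZ b (is_derive_id x 1)).
    by rewrite add0r -[b *: 1]/(b * 1) mulr1.
  have Dc := @is_derive1_comp _ g (fun x => a + b * x) x _ _ (smooth_is_derive (a + b * x) sg) Da.
  have -> : k * b * g^`()%classic (a + b * x) = k *: (g^`()%classic (a + b * x) * b).
    by rewrite -[RHS]/(k * _) -mulrA [b * _]mulrC.
  exact: (is_deriveZ k Dc).
have [? ->] := is_derive1E D.
by split=> //; exists (k * b), (g^`()%classic); split => //; exact: smooth_derive1.
Qed.

(** Neither function alone is stable under derivation; their linear combinations are. *)
Lemma smooth_cos_sin : smooth (@cos R) /\ smooth (@sin R).
Proof.
pose P := fun f : R -> R => exists a b, f = fun x => a * cos x + b * sin x.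
have H f : P f -> smooth f.
  apply: smooth_coind => _ [a [b ->]].
  have D x : is_derive x 1 (fun x => a * cos x + b * sin x) (b * cos x + (- a) * sin x).
    rewrite addrC mulNr -mulrN.
    by apply: (is_deriveD (is_deriveZ a (is_derive_cos x)) (is_deriveZ b (is_derive_sin x))).
  by have [? ->] := is_derive1E D; split=> //; exists b, (- a).
split; apply: H.
  by exists 1, 0; apply/funext => x; rewrite mul1r mul0r addr0.
by exists 0, 1; apply/funext => x; rewrite mul1r mul0r add0r.
Qed.

End Smooth.

(** * A smooth bump function *)

Section Flat.
Context {R : realType}.
Implicit Types (p : {poly R}) (x u : R).

(** The classical exp(-1/x) extended by 0, with a polynomial in 1/x as a factor: derivation replaces
    p by X^2 (p - p'), so this one family contains all derivatives. *)
Definition flat p x : R := if 0 < x then p.[x^-1] * expR (- x^-1) else 0.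

Lemma horner_expRN_bounded p k : exists C : R, 0 <= C /\
  forall u, 0 <= u -> `|p.[u] * u ^+ k * expR (- u)| <= C.
Proof.
elim/poly_ind: p k => [k|p c IH k].
  by exists 0; split=> // u _; rewrite horner0 !mul0r normr0.
have [C [C0 HC]] := IH k.+1.
(* The constant (k+1)! + 1 serves both ranges of u: for u <= 1, u^k <= 1; for u > 1, u^k <= u^(k+1)
   <= (k+1)! e^u by the exponential series. *)
exists (C + `|c| * (k.+1`!%:R + 1)); split.
  by rewrite addr_ge0 // mulr_ge0 // addr_ge0.
move=> u u0; rewrite hornerMXaddC !mulrDl.
apply: (le_trans (ler_normD _ _)); apply: lerD.
  by move: (HC u u0); rewrite exprS !mulrA.
rewrite -mulrA normrM ler_wpM2l // ger0_norm; last first.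
  by rewrite mulr_ge0 ?exprn_ge0 ?expR_ge0.
rewrite expRN ler_pdivrMr ?expR_gt0 //.
have E1 : 1 <= expR u by rewrite -expR0 ler_expR.
have [u1|u1] := leP u 1.
  apply: (@le_trans _ _ 1); first by rewrite exprn_ile1.
  by apply: (le_trans E1); rewrite ler_peMl ?expR_ge0 // lerDr ler0n.
have := expR_ge1Dxn k u0.
have F0 : 0 < k.+1`!%:R :> R by rewrite ltr0n fact_gt0.
rewrite -(ler_pM2l F0) mulrDr mulr1 mulrCA divff ?lt0r_neq0 // mulr1 => H.
have : u ^+ k <= u ^+ k.+1 by rewrite ler_eXn2l // ltW.
have := expR_gt0 u; nra.
Qed.

(** The case k = 2 at u = 1/x. The square makes the difference quotient at 0 of order h, which gives
    derivative 0 there. *)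
Lemma flat_le_sqr p : exists C : R, 0 <= C /\ forall x, `|flat p x| <= C * x ^+ 2.
Proof.
have [C [C0 HC]] := horner_expRN_bounded p 2.
exists C; split=> // x; rewrite /flat; case: ltP => x0; last first.
  by rewrite normr0 mulr_ge0 ?sqr_ge0.
have := HC x^-1; rewrite invr_ge0 ltW // => /(_ isT).
rewrite mulrAC normrM [`|x^-1 ^+ 2|]ger0_norm ?sqr_ge0 // exprVn.
by rewrite ler_pdivrMr // exprn_gt0.
Qed.

Lemma is_derive_flat p x : is_derive x 1 (flat p) (flat ('X^2 * (p - p^`())) x).
Proof.
have [x0|x0|->] := ltgtP x 0.
- have -> : flat ('X^2 * (p - p^`())) x = 0 by rewrite /flat ltNge ltW.
  have D0 := is_derive_cst (0 : R) x 1.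
  apply: near_eq_is_derive D0.
  by near=> y; rewrite /flat ltNge ltW //; near: y; exact: lt_nbhsl.
- rewrite /flat x0 !hornerE.
  pose g y : R := p.[y^-1] * expR (- y^-1).
  suff D : is_derive x 1 g (x^-1 ^+ 2 * (p.[x^-1] - p^`().[x^-1]) * expR (- x^-1)).
    apply: near_eq_is_derive D.
    by near=> y; rewrite ifT //; near: y; exact: lt_nbhsr.
  have DV : is_derive x 1 (fun y => y^-1) (- x ^- 2).
    have := @is_deriveV _ id x 1 1 (lt0r_neq0 x0) (is_derive_id x 1).
    by rewrite -[_ *: 1]/(_ * 1) mulr1.
  have Dp := @is_derive1_comp _ (horner p) (fun y => y^-1) x _ _ (is_derive_poly p x^-1) DV.
  have De := @is_derive1_comp _ expR (fun y => - y^-1) x _ _ (is_derive_expR _) (is_deriveN DV).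
  have -> : x^-1 ^+ 2 * (p.[x^-1] - p^`().[x^-1]) * expR (- x^-1) =
    p.[x^-1] *: (expR (- x^-1) * - - x ^- 2) + expR (- x^-1) *: (p^`().[x^-1] * - x ^- 2).
    by rewrite /GRing.scale /= exprVn opprK; ring.
  exact: (is_deriveM Dp De).
- have [C [C0 HC]] := flat_le_sqr p.
  have f0 q : flat q 0 = 0 by rewrite /flat ltxx.
  rewrite f0.
  have F : h^-1 *: (flat p (h *: 1 + 0) - flat p 0) @[h --> 0^'] --> (0 : R).
    apply/cvgr0Pnorm_le => e e0.
    near=> h.
    have h0 : h != 0 by near: h; exact: nbhs_dnbhs_neq.
    rewrite f0 subr0 addr0 -[h *: 1]/(h * 1) mulr1 normrM normfV.
    rewrite ler_pdivrMl ?normr_gt0 //.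
    apply: (le_trans (HC h)); rewrite -real_normK ?num_real // expr2.
    rewrite mulrA mulrC; apply: ler_wpM2l => //.
    have H : `|h| <= e / (C + 1).
      near: h; apply: dnbhs0_le; rewrite divr_gt0 //; lra.
    apply: (@le_trans _ _ (C * (e / (C + 1)))); first exact: ler_wpM2l.
    rewrite mulrCA ler_piMr ?(ltW e0) // ler_pdivrMr ?mul1r; lra.
  by apply: DeriveDef; [apply/cvg_ex; exists 0|apply: cvg_lim].
Unshelve. all: by end_near. Qed.

Lemma smooth_flat p : smooth (flat p).
Proof.
apply: (@smooth_coind _ (fun f => exists q, f = flat q)); last by exists p.
move=> _ [q ->]; have [? ->] := is_derive1E (is_derive_flat q).
by split; [|exists ('X^2 * (q - q^`()))].
Qed.

Definition bump_fun (d x : R) : R := flat 1 (d + 1 * x) * flat 1 (d + (-1) * x).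

Lemma smooth_bump_fun d : smooth (bump_fun d).
Proof. by apply: smoothM; apply: smooth_affine; exact: smooth_flat. Qed.

Lemma bump_ge0 d x : 0 <= bump_fun d x.
Proof.
by rewrite /bump_fun /flat !hornerC !mul1r mulr_ge0 //; case: ifP => // _; rewrite expR_ge0.
Qed.

Lemma bump0_gt0 d : 0 < d -> 0 < bump_fun d 0.
Proof.
by move=> d0; rewrite /bump_fun /flat !mulr0 addr0 d0 hornerC !mul1r mulr_gt0 ?expR_gt0.
Qed.

Lemma bump_out d x : d <= `|x| -> bump_fun d x = 0.
Proof.
rewrite /bump_fun /flat mul1r mulN1r ler_normr => /orP[] h.
  by rewrite [X in _ * X]ifF ?mulr0 //; apply/negbTE; rewrite -leNgt; lra.
by rewrite ifF ?mul0r //; apply/negbTE; rewrite -leNgt; lra.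
Qed.

End Flat.

(** * Integration and the positive kernel *)

Section Integrals.
Context {R : realType}.
Local Notation mu := (@lebesgue_measure R).
Implicit Types (f g h : R -> R).

(** The measure is arbitrary because this serves both on the line and, for Fubini, on the plane with
    the product measure. *)
Lemma integrable_bounded_support d (T : measurableType d)
    (nu : {measure set T -> \bar R}) (A : set T) (f : T -> R) (M : R) :
  measurable A -> (nu A < +oo)%E -> measurable_fun setT f ->
  (forall x, `|f x| <= M) -> (forall x, ~ A x -> f x = 0) ->
  nu.-integrable setT (EFin \o f).
Proof.
move=> mA nuA mf fM f0.
have -> : EFin \o f = (EFin \o f) \_ A.
  apply/funext => x; rewrite patchE; case: ifPn => //.
  by move=> xA; rewrite /= f0 // => Ax; rewrite mem_set in xA.
apply: (integrable_mkcond _ mA).1; apply: (@measurable_bounded_integrable _ _ _ nu) => //.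
  exact: measurable_funTS.
by exists M; split; [exact: num_real|move=> N /ltW MN x _; exact: le_trans (fM x) MN].
Qed.

Definition compactly_supported f := exists a : R, forall x, a <= `|x| -> f x = 0.

Lemma compactly_supportedP f : compactly_supported f ->
  exists2 a, 0 < a & forall x, ~ `[- a, a]%classic x -> f x = 0.
Proof.
move=> [a H]; exists (Num.max a 1); first by rewrite lt_max ltr01 orbT.
move=> x; rewrite /= in_itv /= -ler_norml => /negP; rewrite -ltNge => h; apply: H.
by rewrite (le_trans _ (ltW h)) // le_max lexx.
Qed.

Lemma compactly_supported_bounded f : continuous f -> compactly_supported f ->
  exists2 M, 0 <= M & forall x, `|f x| <= M.
Proof.
move=> cf /compactly_supportedP[a a0 H].
have ct : {within `[- a, a], continuous f} by exact: continuous_subspaceT.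
have /compact_bounded[M [_ HM]] := continuous_compact ct (@segment_compact _ _ _).
exists (`|M| + 1) => [|x]; first by rewrite addr_ge0.
have [xa|/H ->] := pselect (`[- a, a]%classic x); last by rewrite normr0 addr_ge0.
apply: (HM (`|M| + 1)); last by exists x.
by rewrite (le_lt_trans (ler_norm M)) // ltrDl.
Qed.

Lemma integrable_compactly_supported f : continuous f -> compactly_supported f ->
  mu.-integrable setT (EFin \o f).
Proof.
move=> cf sf; have [M M0 fM] := compactly_supported_bounded cf sf.
have [a a0 H] := compactly_supportedP sf.
pose A : set R := `[- a, a]%classic.
have mA : (mu A < +oo)%E.
  by rewrite lebesgue_measure_itv /=; case: ifP => _; rewrite -?EFinB ltry.
have mf : measurable_fun setT f by exact: continuous_measurable_fun.
exact: (@integrable_bounded_support _ _ mu A f M (measurable_itv _) mA mf fM H).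
Qed.

Lemma compactly_supportedMr f g : compactly_supported f ->
  compactly_supported (fun x => g x * f x).
Proof. by move=> [a H]; exists a => x /H ->; rewrite mulr0. Qed.

Lemma compactly_supported_shift f c : compactly_supported f ->
  compactly_supported (fun x => f (x + c)).
Proof.
move=> [a H]; exists (a + `|c|) => x h; apply: H.
have := ler_normD (x + c) (- c); rewrite addrK normrN; lra.
Qed.

Lemma compactly_supported_derive f : compactly_supported f ->
  compactly_supported (f^`()%classic).
Proof.
(* The extra 1 puts [x] in the interior of the set where [f] vanishes. *)
move=> [a H]; exists (a + 1) => x h.
rewrite derive1E (@near_eq_derive _ _ _ _ (cst 0)) ?derive_cst //.
have xa : a < `|x| by lra.
near=> y; apply: H; apply: ltW.
near: y; have nx : `|z| @[z --> x] --> `|x| by exact: norm_continuous.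
exact: (cvgr_gt `|x| nx).
Unshelve. all: by end_near. Qed.

(** Lebesgue measure is determined by its values on half-open intervals, whose length a translation
    preserves. *)
Lemma lebesgue_measure_shift (c : R) (A : set R) : measurable A ->
  pushforward mu ((fun x => x + c) : measurableTypeR R -> measurableTypeR R) A = mu A.
Proof.
have ms : measurable_fun setT ((fun x => x + c) : measurableTypeR R -> measurableTypeR R).
  exact: measurable_funD.
move=> mA; apply/esym/lebesgue_measure_unique => //= _ [[a b]] _ <-.
rewrite /pushforward /=.
rewrite (_ : _ @^-1` _ = `]a - c, b - c]%classic).
  by rewrite !lebesgue_measure_itv /= !lte_fin ltrD2r; case: ifP => // _; congr EFin; lra.
by apply/seteqP; split=> x /=; rewrite !in_itv /= ltrBlDr lerBrDr.
Qed.

Lemma Rintegral_shift f c : measurable_fun setT f ->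
  mu.-integrable setT (EFin \o (fun x => f (x + c))) ->
  \int[mu]_x f (x + c) = \int[mu]_x f x.
Proof.
move=> mf fi; rewrite /Rintegral; congr fine.
have ms : measurable_fun setT ((fun x => x + c) : measurableTypeR R -> measurableTypeR R).
  exact: measurable_funD.
have mf' : measurable_fun [set: measurableTypeR R] (EFin \o f) by exact/measurable_EFinP.
have fi' : mu.-integrable ((fun x => x + c) @^-1` setT) ((EFin \o f) \o (fun x => x + c)).
  by rewrite preimage_setT.
have := integral_pushforward ms mf' fi' measurableT.
rewrite preimage_setT => /= <-.
by apply: eq_measure_integral => A mA _; exact: (lebesgue_measure_shift c mA).
Qed.

End Integrals.

(** * Autocorrelation of a compactly supported function *)

Section Autocorrelation.
Context {R : realType}.
Local Notation mu := (@lebesgue_measure R).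
Implicit Types (f g h psi : R -> R) (x y t : R).

(** The kernel has [f = g]; two functions are kept apart because derivation in x falls on [g]
    alone. *)
Definition correlation f g x : R := \int[mu]_y (f y * g (x + y)).

Let add_continuous f x : continuous f -> continuous (fun y => f (x + y)).
Proof.
move=> cf y; apply: (@continuous_comp _ _ _ (fun y => x + y) f); last exact: cf.
by apply: cvgD; [exact: cvg_cst|exact: cvg_id].
Qed.

Lemma integrable_correlation f g x : continuous f -> compactly_supported f ->
  continuous g -> mu.-integrable setT (EFin \o (fun y => f y * g (x + y))).
Proof.
move=> cf sf cg; apply: integrable_compactly_supported.
  by move=> y; apply: cvgM; [exact: cf|exact: add_continuous].
by case: sf => a H; exists a => y /H ->; rewrite mul0r.
Qed.

(** Differentiation under the integral sign, dominated by |f| times a bound of g'. As g' is again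
    smooth with compact support, the correlations with fixed [f] form a stable class. *)
Lemma smooth_correlation f g : continuous f -> compactly_supported f ->
  smooth g -> compactly_supported g -> smooth (correlation f g).
Proof.
move=> cf sf sg csg.
apply: (@smooth_coind _ (fun F => exists g, [/\ smooth g, compactly_supported g &
  F = correlation f g])); last by exists g.
move=> _ [{}g [{}sg {}csg ->]].
have dsg := smooth_derive1 sg.
have cdg := compactly_supported_derive csg.
have [M M0 HM] := compactly_supported_bounded (smooth_continuous dsg) cdg.
have D1 x y : is_derive x 1 (fun x => f y * g (x + y)) (f y * g^`()%classic (x + y)).
  have Da : is_derive x 1 (fun x => x + y) 1.
    by have := is_deriveD (is_derive_id x 1) (is_derive_cst y x 1); rewrite addr0.
  have Dc := @is_derive1_comp _ g (fun x => x + y) x _ _ (smooth_is_derive (x + y) sg) Da.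
  by have := is_deriveZ (f y) Dc; rewrite mulr1; apply.
have part x y : partial1of2 (fun x y => f y * g (x + y)) x y = f y * g^`()%classic (x + y).
  by rewrite partial1of2E; case: (D1 x y).
have iG : mu.-integrable setT (EFin \o (fun y => M * `|f y|)).
  apply: integrable_compactly_supported.
    by move=> y; apply: cvgMr; apply: cvg_norm; exact: cf.
  by case: sf => a H; exists a => y /H ->; rewrite normr0 mulr0.
have G0 y : 0 <= M * `|f y| by rewrite mulr_ge0.
have intf x : mu.-integrable setT (EFin \o (fun y => f y * g (x + y))).
  by apply: integrable_correlation => //; exact: smooth_continuous.
have Ix (x : R) : `]x - 1, x + 1[%classic x by rewrite /= in_itv /=; apply/andP; split; lra.
have Gub x z y : `]x - 1, x + 1[%classic z -> [set: R] y ->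
    `|partial1of2 (fun x y => f y * g (x + y)) z y| <= M * `|f y|.
  by move=> _ _; rewrite part normrM mulrC ler_wpM2r.
have der (z y : R) : derivable (fun x => f y * g (x + y)) z 1 by case: (D1 z y).
split=> [x|].
  exact: (@derivable_under_integral R _ _ mu (fun x y => f y * g (x + y)) setT
    measurableT x (x - 1) (x + 1) (Ix x) (fun z _ => intf z) (fun z y _ _ => der z y) _ G0 iG (Gub x)).
exists (g^`()%classic); split => //; apply/funext => x.
rewrite (@differentiation_under_integral R _ _ mu (fun x y => f y * g (x + y)) setT
    measurableT x (x - 1) (x + 1) (Ix x) (fun z _ => intf z) (fun z y _ _ => der z y) _ G0 iG (Gub x)).
by apply: eq_Rintegral => y _; rewrite part.
Qed.

Lemma correlation_out f d x : (forall y, d <= `|y| -> f y = 0) ->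
  2 * d <= `|x| -> correlation f f x = 0.
Proof.
move=> H hx; rewrite /correlation (@eq_Rintegral _ _ _ _ _ (fun=> 0)).
  by rewrite /Rintegral integral0.
move=> y _; have [/H ->|yd] := leP d `|y|; first by rewrite mul0r.
rewrite [f (x + y)]H ?mulr0 //.
have := ler_normD (x + y) (- y); rewrite addrK normrN; lra.
Qed.

Lemma EFin_Rintegral f : mu.-integrable setT (EFin \o f) ->
  (\int[mu]_x f x)%:E = (\int[mu]_x (f x)%:E)%E.
Proof. by move=> fi; rewrite fineK //; exact: integrable_fin_num. Qed.

(** Fubini, followed by the substitution x -> x - y in the inner integral. With a cosine or sine for
    [h], the addition formulas then separate the two copies of [f]. *)
Lemma integral_correlation f h (M : R) : continuous f -> compactly_supported f ->
  continuous h -> (forall x, `|h x| <= M) ->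
  \int[mu]_x (h x * correlation f f x) =
  \int[mu]_y (f y * \int[mu]_x (h (x - y) * f x)).
Proof.
move=> cf sf ch hM.
pose F (z : measurableTypeR R * measurableTypeR R) : R := h z.1 * (f z.2 * f (z.1 + z.2)).
have mcont g : continuous g -> measurable_fun setT (g : measurableTypeR R -> R).
  exact: continuous_measurable_fun.
have m1 : measurable_fun setT (fun z : measurableTypeR R * measurableTypeR R => z.1 : R).
  exact: measurable_fst.
have m2 : measurable_fun setT (fun z : measurableTypeR R * measurableTypeR R => z.2 : R).
  exact: measurable_snd.
have mF : measurable_fun setT F.
  apply: measurable_funM; first exact: (measurableT_comp (mcont _ ch)).
  apply: measurable_funM; first exact: (measurableT_comp (mcont _ cf)).
  exact: (measurableT_comp (mcont _ cf) (measurable_funD m1 m2)).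
have [Mf Mf0 HMf] := compactly_supported_bounded cf sf.
have [a a0 Ha] := compactly_supportedP sf.
(* The radius is 2a because |y| <= a and |x + y| <= a force |x| <= 2a. *)
pose A : set R := `[- (2 * a), 2 * a]%classic.
have mA : measurable A by exact: measurable_itv.
have muA : (mu A < +oo)%E.
  by rewrite lebesgue_measure_itv /=; case: ifP => _; rewrite -?EFinB ltry.
have iF : (mu \x mu)%E.-integrable setT (EFin \o F).
  refine (@integrable_bounded_support R _ _ (mu \x mu)%E (A `*` A) F (M * (Mf * Mf)) _ _ mF _ _).
  - exact: measurableX.
  - have E := @product_measure1E _ _ _ _ R mu mu A A mA mA.
    apply: (@eq_ind_r _ _ (fun z => (z < +oo)%E) _ _ E).
    by rewrite lte_mul_pinfty // ge0_fin_numE.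
  - move=> z; rewrite !normrM; apply: ler_pM => //; try exact: mulr_ge0.
    exact: ler_pM.
  - move=> [x y] nA; rewrite /F /=.
    have [ya|/Ha ->] := pselect (`[- a, a]%classic y); last by rewrite mul0r mulr0.
    have [xya|/Ha ->] := pselect (`[- a, a]%classic (x + y)); last by rewrite !mulr0.
    exfalso; apply: nA; move: ya xya; rewrite /A /= !in_itv /= => /andP[? ?] /andP[? ?].
    by split; apply/andP; split; lra.
have := Fubini iF; rewrite /F /=.
have E1 x : (\int[mu]_y (h x * (f y * f (x + y)))%:E)%E = (h x * correlation f f x)%:E.
  have I := integrable_correlation x cf sf cf.
  rewrite /correlation -RintegralZl // EFin_Rintegral //.
  by apply: (integrableZl _ (h x) I).
have E2 y : (\int[mu]_x (h x * (f y * f (x + y)))%:E)%E =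
    (f y * \int[mu]_x (h (x - y) * f x))%:E.
  pose k x := h (x - y) * f x.
  have ck : continuous k.
    move=> x; apply: cvgM; last exact: cf.
    apply: (@continuous_comp _ _ _ (fun x => x - y) h); last exact: ch.
    by apply: cvgB; [exact: cvg_id|exact: cvg_cst].
  have sk : compactly_supported k by exact: compactly_supportedMr.
  have ik : mu.-integrable setT (EFin \o (fun x => k (x + y))).
    apply: integrable_compactly_supported; last exact: compactly_supported_shift.
    move=> x; apply: (@continuous_comp _ _ _ (fun x => x + y) k); last exact: ck.
    by apply: cvgD; [exact: cvg_id|exact: cvg_cst].
  rewrite -/(Rintegral mu setT k) -(Rintegral_shift _ ik); last exact: mcont.
  rewrite -RintegralZl // EFin_Rintegral //; last exact: (integrableZl _ (f y) ik).
  by apply: eq_integral => x _; congr EFin; rewrite /k addrK; ring.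
under eq_integral do rewrite E1.
under [X in _ = X -> _]eq_integral do rewrite E2.
by rewrite /Rintegral => ->.
Qed.

End Autocorrelation.

(** * Cosine and sine transforms *)

Section FourierKernel.
Context {R : realType}.
Local Notation mu := (@lebesgue_measure R).
Implicit Types (f g h psi : R -> R) (x y t : R).

Lemma Rintegral_derive1_eq0 f : smooth f -> compactly_supported f ->
  \int[mu]_x (f^`()%classic x) = 0.
Proof.
move=> sf csf; have [a Ha] := csf; have [b Hb] := compactly_supported_derive csf.
pose m := Num.max (Num.max a b) 1.
have m0 : 0 < m by rewrite lt_max ltr01 orbT.
have ma : a <= m by rewrite !le_max lexx.
have mb : b <= m by rewrite !le_max lexx orbT.
have -> : \int[mu]_x (f^`()%classic x) = \int[mu]_(x in `[- m, m]) (f^`()%classic x).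
  rewrite [RHS]Rintegral_mkcond; apply: eq_Rintegral => x _.
  rewrite patchE; case: ifPn => // /negP nx; apply: Hb; apply: (le_trans mb).
  rewrite leNgt; apply/negP => h; apply: nx; rewrite inE /= in_itv /= -ler_norml ltW //.
have cf := smooth_continuous sf.
rewrite /Rintegral (@continuous_FTC2 _ _ f) //.
- by rewrite !Ha ?normrN ?(ger0_norm (ltW m0)) // subee.
- by lra.
- by apply: continuous_subspaceT; exact: (smooth_continuous (smooth_derive1 sf)).
- split; first by move=> x _; exact: smooth_derivable.
  + by apply: cvg_at_right_filter; exact: cf.
  + by apply: cvg_at_left_filter; exact: cf.
Qed.

Definition cos_transform psi t : R := \int[mu]_x (cos (t * x) * psi x).
Definition sin_transform psi t : R := \int[mu]_x (sin (t * x) * psi x).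

Lemma smooth_cosM t : smooth (fun x => cos (t * x)).
Proof.
have := @smooth_affine R _ 0 t (proj1 (@smooth_cos_sin R)).
by congr smooth; apply/funext => x; rewrite add0r.
Qed.

Lemma smooth_sinM t : smooth (fun x => sin (t * x)).
Proof.
have := @smooth_affine R _ 0 t (proj2 (@smooth_cos_sin R)).
by congr smooth; apply/funext => x; rewrite add0r.
Qed.

Lemma integrable_smoothM h psi : continuous h -> continuous psi ->
  compactly_supported psi -> mu.-integrable setT (EFin \o (fun x => h x * psi x)).
Proof.
move=> ch cp sp; apply: integrable_compactly_supported; last exact: compactly_supportedMr.
by move=> x; apply: cvgM; [exact: ch|exact: cp].
Qed.

Lemma Rintegral_lin f g (a b : R) : mu.-integrable setT (EFin \o f) ->
  mu.-integrable setT (EFin \o g) ->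
  \int[mu]_x (a * f x + b * g x) = a * (\int[mu]_x f x) + b * (\int[mu]_x g x).
Proof.
move=> fi gi; rewrite RintegralD //; first by rewrite !RintegralZl.
  exact: (integrableZl _ a fi).
exact: (integrableZl _ b gi).
Qed.

Section Transform.
Variable psi : R -> R.
Hypotheses (cpsi : continuous psi) (spsi : compactly_supported psi).

Let ccos t : continuous (fun x => cos (t * x)).
Proof. by apply: smooth_continuous; apply: smooth_cosM. Qed.
Let csin t : continuous (fun x => sin (t * x)).
Proof. by apply: smooth_continuous; apply: smooth_sinM. Qed.
Let icos t := integrable_smoothM (@ccos t) cpsi spsi.
Let isin t := integrable_smoothM (@csin t) cpsi spsi.

(** The right-hand side is the squared modulus of the Fourier transform of [psi]: the source of the
    nonnegative weight. *)
Lemma cos_transform_correlation t :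
  cos_transform (correlation psi psi) t = cos_transform psi t ^+ 2 + sin_transform psi t ^+ 2.
Proof.
rewrite {1}/cos_transform.
rewrite (integral_correlation cpsi spsi (@ccos t) (fun x => cos_max _)).
have E y : psi y * \int[mu]_x (cos (t * (x - y)) * psi x) =
   cos_transform psi t * (cos (t * y) * psi y) + sin_transform psi t * (sin (t * y) * psi y).
  rewrite (_ : \int[mu]_x _ = cos (t * y) * cos_transform psi t + sin (t * y) * sin_transform psi t).
    by ring.
  rewrite -Rintegral_lin //; apply: eq_Rintegral => x _.
  by rewrite mulrBr cosB; ring.
under eq_Rintegral do rewrite E.
by rewrite Rintegral_lin.
Qed.

(** sin (t (x - y)) is antisymmetric in x and y, so the two products in its expansion cancel. The
    transform of the autocorrelation is thus real. *)
Lemma sin_transform_correlation t : sin_transform (correlation psi psi) t = 0.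
Proof.
rewrite {1}/sin_transform.
rewrite (integral_correlation cpsi spsi (@csin t) (fun x => sin_max _)).
have E y : psi y * \int[mu]_x (sin (t * (x - y)) * psi x) =
   sin_transform psi t * (cos (t * y) * psi y) + (- cos_transform psi t) * (sin (t * y) * psi y).
  rewrite (_ : \int[mu]_x _ = cos (t * y) * sin_transform psi t + (- sin (t * y)) * cos_transform psi t).
    by ring.
  rewrite -Rintegral_lin //; apply: eq_Rintegral => x _.
  by rewrite mulrBr sinB; ring.
under eq_Rintegral do rewrite E.
by rewrite Rintegral_lin // -/(cos_transform psi t) -/(sin_transform psi t); ring.
Qed.

Lemma norm_integral_le h : continuous h -> (forall x, `|h x| <= 1) ->
  `|\int[mu]_x (h x * psi x)| <= \int[mu]_x `|psi x|.
Proof.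
move=> ch h1; have I := integrable_smoothM ch cpsi spsi.
apply: (le_trans (le_normr_Rintegral measurableT I)).
apply: le_Rintegral => //.
- exact: (integrable_norm I).
- exact: (integrable_norm (integrable_compactly_supported cpsi spsi)).
- by move=> x _; rewrite normrM ler_piMl.
Qed.

Lemma continuous_transform h : continuous h -> (forall x, `|h x| <= 1) ->
  continuous (fun t => \int[mu]_x (h (t * x) * psi x)).
Proof.
move=> ch h1 t.
have cht s : continuous (fun x => h (s * x)).
  move=> x; apply: (@continuous_comp _ _ _ (fun x => s * x) h); last exact: ch.
  by apply: cvgMr; exact: cvg_id.
have It : t \in `]t - 1, t + 1[%classic.
  by rewrite inE /= in_itv /=; apply/andP; split; lra.
apply: (@continuity_under_integral R _ _ mu (fun t x => h (t * x) * psi x) setT measurableT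
  (t - 1) (t + 1) _ _ (fun x => `|psi x|) _ _ t It).
- by move=> s _; exact: integrable_smoothM.
- apply: aeW => x _ s _; apply: cvgMl.
  have ct : continuous (fun s : R => h (s * (x : R))).
    rewrite (_ : (fun s : R => _) = fun s => h ((x : R) * s)); first exact: cht.
    by apply/funext => z; rewrite mulrC.
  exact: (ct s).
- exact: (integrable_norm (integrable_compactly_supported cpsi spsi)).
- by move=> s _; apply: aeW => x _; rewrite normrM ler_piMl.
Qed.

End Transform.
End FourierKernel.

(** * Decay of the transforms and the positive kernel *)

Section Kernel.
Context {R : realType}.
Local Notation mu := (@lebesgue_measure R).
Implicit Types (f g h k psi : R -> R) (x y t : R).

Lemma smoothD f g : smooth f -> smooth g -> smooth (fun x => f x + g x).
Proof.
move=> sf sg; have s1 := @smooth_cst R 1.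
have := smooth_products_smooth (smooth_products_add (smooth_product s1 sf) (smooth_product s1 sg)).
by congr smooth; apply/funext => x; rewrite !mul1r.
Qed.

(* For k = cos (t .) or k = sin (t .), this is two integrations by parts. *)
Lemma oscillatory_integral_derive2 psi h k t : smooth psi -> compactly_supported psi ->
  smooth h -> smooth k ->
  (forall x, is_derive x 1 h (t * k x)) -> (forall x, is_derive x 1 k (- (t * h x))) ->
  t ^+ 2 * \int[mu]_x (k x * psi x) =
  - \int[mu]_x (k x * psi^`()%classic^`()%classic x).
Proof.
move=> sp csp sh sk Dh Dk.
have sp' := smooth_derive1 sp; have sp'' := smooth_derive1 sp'.
have csp' := compactly_supported_derive csp.
have csp'' := compactly_supported_derive csp'.
(* [f] is the sum of the boundary terms of both integrations by parts; in its derivative the terms t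
   h psi' cancel. *)
pose f x := t * (h x * psi x) + k x * psi^`()%classic x.
have sf : smooth f.
  apply: smoothD; last exact: smoothM.
  by apply: smoothM; [exact: smooth_cst|exact: smoothM].
have csf : compactly_supported f.
  have [a Ha] := csp; have [b Hb] := csp'; exists (Num.max a b) => x.
  by rewrite ge_max => /andP[/Ha e1 /Hb e2]; rewrite /f e1 e2 !mulr0 addr0.
have Df x : is_derive x 1 f (t ^+ 2 * (k x * psi x) + 1 * (k x * psi^`()%classic^`()%classic x)).
  have D1 := is_deriveZ t (is_deriveM (Dh x) (smooth_is_derive x sp)).
  have D2 := is_deriveM (Dk x) (smooth_is_derive x sp').
  have := is_deriveD D1 D2; congr is_derive.
  by rewrite /GRing.scale /=; ring.
have /(_ sf csf) := @Rintegral_derive1_eq0 R f.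
have [_ ->] := is_derive1E Df.
rewrite Rintegral_lin; first by rewrite mul1r => /eqP; rewrite addr_eq0 => /eqP.
- by apply: integrable_smoothM => //; exact: smooth_continuous.
- by apply: integrable_smoothM => //; exact: smooth_continuous.
Qed.

Lemma is_derive_cosM t x : is_derive x 1 (fun x => cos (t * x)) (- (t * sin (t * x))).
Proof.
have Dt : is_derive x 1 (fun x => t * x) t.
  by have := is_deriveZ t (is_derive_id x 1); rewrite -[_ *: 1]/(_ * 1) mulr1.
have := @is_derive1_comp _ cos (fun x => t * x) x _ _ (is_derive_cos _) Dt.
by rewrite mulNr [sin _ * t]mulrC.
Qed.

Lemma is_derive_sinM t x : is_derive x 1 (fun x => sin (t * x)) (t * cos (t * x)).
Proof.
have Dt : is_derive x 1 (fun x => t * x) t.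
  by have := is_deriveZ t (is_derive_id x 1); rewrite -[_ *: 1]/(_ * 1) mulr1.
have := @is_derive1_comp _ sin (fun x => t * x) x _ _ (is_derive_sin _) Dt.
by rewrite [cos _ * t]mulrC.
Qed.

(** The summand 1 of the weight is paid by the integral of |psi|, the summand t^2 by that of
    |psi''|. Squaring in the autocorrelation turns this decay t^-2 into t^-4. *)
Lemma transform_decay psi : smooth psi -> compactly_supported psi ->
  exists2 K, 0 <= K & forall t,
    (1 + t ^+ 2) * `|cos_transform psi t| <= K /\
    (1 + t ^+ 2) * `|sin_transform psi t| <= K.
Proof.
move=> sp csp.
have sp'' := smooth_derive1 (smooth_derive1 sp).
have csp'' := compactly_supported_derive (compactly_supported_derive csp).
exists (\int[mu]_x `|psi x| + \int[mu]_x `|psi^`()%classic^`()%classic x|).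
  by rewrite addr_ge0 // Rintegral_ge0.
move=> t.
have key h k : smooth h -> smooth k ->
    (forall x, is_derive x 1 h (t * k x)) -> (forall x, is_derive x 1 k (- (t * h x))) ->
    (forall x, `|k x| <= 1) ->
    (1 + t ^+ 2) * `|\int[mu]_x (k x * psi x)| <=
    \int[mu]_x `|psi x| + \int[mu]_x `|psi^`()%classic^`()%classic x|.
  move=> sh sk Dh Dk k1; rewrite mulrDl mul1r; apply: lerD.
    apply: norm_integral_le => //; exact: smooth_continuous.
  rewrite -[t ^+ 2]ger0_norm ?sqr_ge0 // -normrM.
  rewrite (oscillatory_integral_derive2 sp csp sh sk Dh Dk) normrN.
  apply: norm_integral_le => //; exact: smooth_continuous.
split.
- apply: (key (fun x => sin (t * x)) (fun x => cos (t * x))).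
  + exact: smooth_sinM.
  + exact: smooth_cosM.
  + exact: is_derive_sinM.
  + exact: is_derive_cosM.
  + by move=> x; exact: cos_max.
- apply: (key (fun x => - cos (t * x)) (fun x => sin (t * x))).
  + have := smoothM (@smooth_cst R (-1)) (@smooth_cosM R t).
    by congr smooth; apply/funext => x; rewrite mulN1r.
  + exact: smooth_sinM.
  + by move=> x; have := is_deriveN (is_derive_cosM t x); rewrite opprK.
  + by move=> x; rewrite mulrN opprK; exact: is_derive_sinM.
  + by move=> x; exact: sin_max.
Qed.

Lemma Rintegral_gt0 f : continuous f -> compactly_supported f ->
  (forall x, 0 <= f x) -> 0 < f 0 -> 0 < \int[mu]_x f x.
Proof.
move=> cf csf f0 f00.
have h0 : f 0 / 2 < f 0 by lra.
have cf0 : f x @[x --> (0 : R)] --> f 0 by exact: cf.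
have [e /= e0 He] := (nbhs_ballP (0 : R) (fun x => f 0 / 2 < f x)).1 (cvgr_gt (f 0) cf0 _ h0).
pose A : set R := `[- (e / 2), e / 2]%classic.
have mA : measurable A by exact: measurable_itv.
have iA : mu.-integrable setT (EFin \o (fun x => f 0 / 2 * \1_A x)).
  exact: (integrableZl _ (f 0 / 2) (integrable_indic_itv _ _ _ _)).
apply: (@lt_le_trans _ _ (\int[mu]_x (f 0 / 2 * \1_A x))).
  rewrite RintegralZl //; last exact: integrable_indic_itv.
  apply: mulr_gt0; first lra.
  have E : (\int[mu]_x (\1_A x)%:E)%E = e%:E.
    rewrite integral_indic // setIT.
    have : mu A = e%:E; last exact.
    by rewrite lebesgue_measure_itv /= lte_fin ifT -?EFinD; [congr EFin|]; lra.
  by rewrite /Rintegral E.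
apply: le_Rintegral => //; first exact: integrable_compactly_supported.
move=> x _; rewrite indicE; case: (boolP (x \in A)) => xA; last by rewrite mulr0.
rewrite mulr1; apply: ltW; apply: He; rewrite /ball /= sub0r normrN.
move: xA; rewrite inE /A /= in_itv /= -ler_norml; lra.
Qed.

Lemma oneDsqrV_integrable : mu.-integrable setT (EFin \o (fun x => (oneDsqr x)^-1)).
Proof.
have c := @continuous_oneDsqrV R.
apply/integrableP; split; first by apply/measurable_EFinP; exact: continuous_measurable_fun.
have p x : 0 <= (oneDsqr x)^-1 :> R by rewrite invr_ge0 addr_ge0 ?sqr_ge0.
under eq_integral => x _ do rewrite /= ger0_norm //.
rewrite ge0_symfun_integralT //; last by move=> x; rewrite /= /oneDsqr sqrrN.
by rewrite -set_itvcy integral0y_oneDsqr -EFinM ltry.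
Qed.

(** The transform of [phi] is [w], stated through its real and imaginary parts. The support has
    radius e/2 because a test function on ]-e, e[ must vanish outside a strictly smaller interval.
    Continuity of [w] provides its measurability. *)
Record positive_kernel (e : R) (phi w : R -> R) : Prop := PositiveKernel {
  pk_smooth : smooth phi;
  pk_support : forall x, e / 2 <= `|x| -> phi x = 0;
  pk_cos : forall t, cos_transform phi t = w t;
  pk_sin : forall t, sin_transform phi t = 0;
  pk_ge0 : forall t, 0 <= w t;
  pk_gt0 : 0 < w 0;
  pk_cont : continuous w;
  pk_decay : exists2 K, 0 <= K & forall t, w t <= K * (oneDsqr t)^-1 ^+ 2 }.

Lemma positive_kernel_exists (e : R) : 0 < e -> exists phi w, positive_kernel e phi w.
Proof.
(* Autocorrelation doubles the support, from radius e/4 to e/2. *)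
move=> e0; pose psi := bump_fun (e / 4).
have sp : smooth psi by exact: smooth_bump_fun.
have cp := smooth_continuous sp.
have op x : e / 4 <= `|x| -> psi x = 0 by exact: bump_out.
have csp : compactly_supported psi by exists (e / 4).
exists (correlation psi psi), (fun t => cos_transform psi t ^+ 2 + sin_transform psi t ^+ 2).
split.
- exact: smooth_correlation.
- by move=> x h; apply: (correlation_out op); lra.
- by move=> t; exact: cos_transform_correlation.
- by move=> t; exact: sin_transform_correlation.
- by move=> t; rewrite addr_ge0 ?sqr_ge0.
- apply: ltr_wpDr; first exact: sqr_ge0.
  apply: exprn_gt0; rewrite /cos_transform.
  under eq_Rintegral do rewrite mul0r cos0 mul1r.
  by apply: Rintegral_gt0 => //; [exact: bump_ge0|apply: bump0_gt0; lra].
- have c1 := continuous_transform cp csp (@continuous_cos R) (@cos_max R).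
  have c2 := continuous_transform cp csp (@continuous_sin R) (@sin_max R).
  rewrite (_ : (fun t => _) = (fun t => cos_transform psi t * cos_transform psi t +
      sin_transform psi t * sin_transform psi t)); last first.
    by apply/funext => t; rewrite !expr2.
  by move=> t; exact: (cvgD (cvgM (c1 t) (c1 t)) (cvgM (c2 t) (c2 t))).
- have [K K0 HK] := transform_decay sp csp.
  (* Each of the two squares is at most K^2 / (1 + t^2)^2. *)
  exists (2 * K ^+ 2) => [|t]; first by rewrite mulr_ge0 ?sqr_ge0.
  have p : 0 < oneDsqr t by rewrite ltr_pwDl ?sqr_ge0.
  rewrite exprVn ler_pdivlMr ?exprn_gt0 //.
  have sq z : (1 + t ^+ 2) * `|z| <= K -> z ^+ 2 * oneDsqr t ^+ 2 <= K ^+ 2.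
    move=> h; rewrite -exprMn -real_normK ?num_real // normrM (gtr0_norm p) mulrC.
    by rewrite ler_sqr ?nnegrE // mulr_ge0 // ltW.
  have [/sq h1 /sq h2] := HK t.
  by rewrite mulrDl mulrC [X in _ + X]mulrC mulr_natl mulr2n; apply: lerD; rewrite mulrC.
Qed.

End Kernel.

(** * The Tauberian argument on sequences *)

Section Tauberian.
Context {R : realType}.

(** Telescoping against F(x) = x / (1 + |x|). The points n - N are integers, so no unit step crosses
    0, and on each side F(x+1) - F(x) = 1 / ((1 + |x|)(1 + |x+1|)), which is at least a quarter of 1
    / (1 + x^2). As F has values in [-1, 1], the total is at most 4 * 2. *)
Lemma sum_oneDsqrV_le (M N : nat) :
  \sum_(n < M) (1 + (n%:R - N%:R) ^+ 2)^-1 <= 8 :> R.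
Proof.
pose F (x : R) := x / (1 + `|x|).
have F1 x : `|F x| <= 1.
  have p : 0 < 1 + `|x| by rewrite ltr_pwDl.
  rewrite normrM normfV (gtr0_norm p) ler_pdivrMr // mul1r; lra.
suff H : \sum_(n < M) (1 + (n%:R - N%:R) ^+ 2)^-1 <= 4 * (F (M%:R - N%:R) - F (0 - N%:R)).
  apply: (le_trans H); have := F1 (M%:R - N%:R); have := F1 (0 - N%:R).
  by rewrite !ler_norml; lra.
elim: M => [|M IH]; first by rewrite big_ord0 subrr mulr0.
rewrite big_ord_recr /=.
suff : (1 + (M%:R - N%:R) ^+ 2)^-1 <= 4 * (F (M.+1%:R - N%:R) - F (M%:R - N%:R)) by lra.
have xE : M.+1%:R - N%:R = (M%:R - N%:R) + 1 :> R by rewrite -natr1; ring.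
rewrite xE; have [NM|MN] := leqP N M.
  have : 0 <= M%:R - N%:R :> R by rewrite subr_ge0 ler_nat.
  move: (M%:R - N%:R) => x x0; rewrite /F !ger0_norm ?addr_ge0 //.
  have p1 : 0 < 1 + x by lra.
  have p2 : 0 < 1 + (x + 1) by lra.
  rewrite (_ : _ - _ = ((1 + x) * (1 + (x + 1)))^-1); last by field; rewrite !gt_eqF.
  rewrite -[4]invrK -invfM lef_pV2 ?posrE; nra.
have : (M%:R - N%:R) + 1 <= 0 :> R by rewrite -xE subr_le0 ler_nat.
move: (M%:R - N%:R) => x x0; rewrite /F !ler0_norm ?(le_trans _ x0) //; try lra.
have p1 : 0 < 1 - x by lra.
have p2 : 0 < 1 - (x + 1) by lra.
rewrite (_ : _ - _ = ((1 - x) * (1 - (x + 1)))^-1); last by field; rewrite !gt_eqF.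
rewrite -[4]invrK -invfM lef_pV2 ?posrE; nra.
Qed.

(** [W] bounds the weighted sums uniformly in both the length and the centre N; it is the price of a
    defect eta (1 + (n - N)^2) per unit of eta. *)
Variables (w : R -> R) (W : R).
Hypotheses (w_ge0 : forall x, 0 <= w x) (w0_gt0 : 0 < w 0).
Hypothesis sum_w : forall M N : nat,
  \sum_(n < M) (1 + (n%:R - N%:R) ^+ 2) * w (n%:R - N%:R) <= W.

(** [B N r] is the sum of s_n r^n smoothed around N, and [beta N] its limit as r -> 1. The sequence
    is an abstract real one so as to stand for real and for imaginary parts. *)
Variables (s : nat -> R) (B : nat -> R -> R) (beta : nat -> R).
Hypothesis HB : forall N r, 0 < r < 1 ->
  series (fun n => s n * r ^+ n * w (n%:R - N%:R)) @ \oo --> B N r.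
Hypothesis Hbeta : forall N, B N r @[r --> 1^'-] --> beta N.

Let near1 : \forall r \near (1 : R)^'-, 0 < r < 1.
Proof.
near=> r; apply/andP; split; last by near: r; exact: nbhs_left_lt.
by near: r; apply: nbhs_left_gt; exact: ltr01.
Unshelve. all: by end_near. Qed.

Let cvg1X k : r ^+ k @[r --> (1 : R)^'-] --> (1 : R).
Proof.
have := @exprn_continuous R k 1; rewrite /continuous_at expr1n => h.
exact: cvg_at_left_filter.
Qed.

Lemma weight_le (N : nat) (n : nat) : (1 + (n%:R - N%:R) ^+ 2) * w (n%:R - N%:R) <= W.
Proof.
apply: le_trans (sum_w n.+1 N); rewrite big_ord_recr /= lerDr sumr_ge0 // => i _.
by rewrite mulr_ge0 // addr_ge0 ?sqr_ge0.
Qed.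

(** In B_(N+1) - r B_N the increments appear with the weights w(n - N). Adding eta (1 + (n - N)^2)
    makes them all nonnegative at a total cost of eta W, after which the single term n = N is
    bounded by the whole. *)
Lemma increment_upper_bound (eta : R) (N : nat) : 0 <= eta ->
  (forall n, 0 <= s n.+1 - s n + eta * (1 + (n%:R - N%:R) ^+ 2)) ->
  (s N.+1 - s N) * w 0 <= beta N.+1 - beta N - s 0%N * w (0 - N.+1%:R) + eta * W.
Proof.
move=> eta0 Hc.
suff H r : 0 < r < 1 -> (s N.+1 - s N + eta) * r ^+ N.+1 * w 0 <=
    B N.+1 r - r * B N r - s 0%N * w (0 - N.+1%:R) + eta * W.
  have : (s N.+1 - s N + eta) * 1 * w 0 <= beta N.+1 - 1 * beta N - s 0%N * w (0 - N.+1%:R) + eta * W.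
    apply: (@ler_cvg_to _ ((1 : R)^'-) _ _ (fun r => (s N.+1 - s N + eta) * r ^+ N.+1 * w 0)
      (fun r => B N.+1 r - r * B N r - s 0%N * w (0 - N.+1%:R) + eta * W)).
    - by apply: cvgMl; apply: cvgMr; exact: cvg1X.
    - apply: cvgD; last exact: cvg_cst.
      apply: cvgB; last exact: cvg_cst.
      apply: cvgB; first exact: Hbeta.
      by apply: cvgM; [exact: (cvg1X 1)|exact: Hbeta].
    - by apply: filterS near1 => r; exact: H.
  rewrite mulr1 mul1r mulrDl; have := mulr_ge0 eta0 (w_ge0 0); lra.
move=> /andP[r0 r1].
pose P N M := \sum_(n < M) s n * r ^+ n * w (n%:R - N%:R).
have PB K : P K M @[M --> \oo] --> B K r.
  have := @HB K r; rewrite r0 r1 => /(_ isT); rewrite /series /P /=.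
  by under eq_fun do rewrite big_mkord.
(* Moving n and N together leaves w(n - N) unchanged, and the factor r aligns the powers; only the
   term n = 0 of the first sum remains unpaired. *)
have E M : P N.+1 M.+1 - r * P N M = s 0%N * w (0 - N.+1%:R) +
    \sum_(n < M) (s n.+1 - s n) * r ^+ n.+1 * w (n%:R - N%:R).
  rewrite /P big_ord_recl /= expr0 mulr1 -addrA; congr (_ + _).
  rewrite mulr_sumr -sumrB; apply: eq_bigr => i _.
  rewrite /fintype.bump /= add1n !mulrBl; congr (_ - _); last by rewrite exprS; ring.
  by congr (_ * w _); rewrite -!natr1; ring.
apply: (@ler_cvg_to _ \oo _ _ (fun=> (s N.+1 - s N + eta) * r ^+ N.+1 * w 0)
  (fun M => P N.+1 M.+1 - r * P N M - s 0%N * w (0 - N.+1%:R) + eta * W)).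
- exact: cvg_cst.
- apply: cvgD; last exact: cvg_cst.
  apply: cvgB; last exact: cvg_cst.
  apply: cvgB; last by apply: cvgMr; exact: PB.
  by have := PB N.+1; rewrite -(cvg_shiftS (P N.+1)).
exists N.+1 => // M /= NM; rewrite E (addrC (s 0%N * _)) addrK.
(* All terms but n = N are dropped; there the added weight is just eta. *)
apply: (@le_trans _ _ (\sum_(n < M) (s n.+1 - s n + eta * (1 + (n%:R - N%:R) ^+ 2)) *
    r ^+ n.+1 * w (n%:R - N%:R))).
  rewrite (bigD1 (Ordinal NM)) //= subrr expr0n /= addr0 mulr1 lerDl sumr_ge0 // => i _.
  by rewrite !mulr_ge0 // exprn_ge0 // ltW.
under eq_bigr do rewrite mulrDl mulrDl.
rewrite big_split /= lerD2l; apply: le_trans (ler_wpM2l eta0 (sum_w M N)).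
rewrite mulr_sumr; apply: ler_sum => i _.
rewrite -!mulrA ler_wpM2l // ler_wpM2l ?addr_ge0 ?sqr_ge0 //.
by rewrite ler_piMl // exprn_ile1 // ltW.
Qed.

(** Replacing s_n by s_N in the smoothed sum costs at most eta W and leaves s_N times a sum of
    nonnegative weights, which is at least its term r^N w(0). *)
Lemma term_bound (eta : R) (N : nat) : 0 <= eta ->
  (forall n, `|s n - s N| <= eta * (1 + (n%:R - N%:R) ^+ 2)) ->
  `|s N| * w 0 <= `|beta N| + eta * W.
Proof.
move=> eta0 Hs.
suff H r : 0 < r < 1 -> `|s N| * r ^+ N * w 0 <= `|B N r| + eta * W.
  have : `|s N| * 1 * w 0 <= `|beta N| + eta * W; last by rewrite mulr1.
  apply: (@ler_cvg_to _ ((1 : R)^'-) _ _ (fun r => `|s N| * r ^+ N * w 0)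
      (fun r => `|B N r| + eta * W)).
  - by apply: cvgMl; apply: cvgMr; exact: cvg1X.
  - by apply: cvgD; [apply: cvg_norm; exact: Hbeta|exact: cvg_cst].
  - by apply: filterS near1 => r; exact: H.
move=> /andP[r0 r1].
pose P M := \sum_(n < M) s n * r ^+ n * w (n%:R - N%:R).
have PB : P M @[M --> \oo] --> B N r.
  have := @HB N r; rewrite r0 r1 => /(_ isT); rewrite /series /P /=.
  by under eq_fun do rewrite big_mkord.
apply: (@ler_cvg_to _ \oo _ _ (fun=> `|s N| * r ^+ N * w 0) (fun M => `|P M| + eta * W)).
- exact: cvg_cst.
- by apply: cvgD; [apply: cvg_norm|exact: cvg_cst].
exists N.+1 => // M /= NM.
have rn n : 0 <= r ^+ n by rewrite exprn_ge0 // ltW.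
pose Q := \sum_(n < M) r ^+ n * w (n%:R - N%:R).
have Q0 : r ^+ N * w 0 <= Q.
  rewrite /Q (bigD1 (Ordinal NM)) //= subrr lerDl sumr_ge0 // => i _.
  by rewrite mulr_ge0.
apply: (@le_trans _ _ (`|s N * Q|)).
  rewrite normrM -mulrA ler_wpM2l // (le_trans Q0) // ler_norm //.
have -> : s N * Q = P M - \sum_(n < M) (s n - s N) * (r ^+ n * w (n%:R - N%:R)).
  rewrite /P /Q mulr_sumr -sumrB; apply: eq_bigr => i _; ring.
apply: (le_trans (ler_normB _ _)); rewrite lerD2l.
apply: (le_trans (ler_norm_sum _ _ _)).
apply: le_trans (ler_wpM2l eta0 (sum_w M N)).
rewrite mulr_sumr; apply: ler_sum => i _.
rewrite normrM [`|_ * w _|]ger0_norm ?mulr_ge0 // [leRHS]mulrA.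
apply: ler_pM => //; first exact: mulr_ge0.
by rewrite ler_piMl // exprn_ile1 // ltW.
Qed.

Lemma increments_le (delta : R) (n1 : nat) :
  (forall n, (n1 <= n)%N -> `|s n.+1 - s n| <= delta) ->
  forall n N, (n1 <= n)%N -> (n1 <= N)%N -> `|s n - s N| <= delta * `|n%:R - N%:R|.
Proof.
move=> H; have up n k : (n1 <= n)%N -> `|s (n + k)%N - s n| <= delta * k%:R.
  move=> h; elim: k => [|k IH]; first by rewrite addn0 subrr normr0 mulr0.
  rewrite addnS (_ : s _.+1 - s n = (s (n + k).+1 - s (n + k)%N) + (s (n + k)%N - s n)); last by ring.
  apply: (le_trans (ler_normD _ _)); rewrite -natr1 mulrDr mulr1 addrC; apply: lerD => //.
  by apply: H; rewrite (leq_trans h) // leq_addr.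
move=> n N hn hN; have [nN|Nn] := leqP n N.
  rewrite distrC [`|n%:R - _|]distrC -(subnKC nN) natrD [_ + _ - _]addrAC subrr add0r.
  by rewrite [`|(_ - _)%:R|]ger0_norm //; exact: up.
rewrite -(subnKC (ltnW Nn)) natrD [_ + _ - _]addrAC subrr add0r.
by rewrite [`|(_ - _)%:R|]ger0_norm //; exact: up.
Qed.

(** Turns a Lipschitz bound on [s] into the quadratic deviation that [term_bound] takes. *)
Let norm_le_weight (x : R) : `|x| <= 1 + x ^+ 2.
Proof. by rewrite -[x ^+ 2]real_normK ?num_real //; have := sqr_ge0 (`|x| - 1); nra. Qed.

Let W_ge0 : 0 <= W.
Proof. by apply: le_trans (sum_w 0 0); rewrite big_ord0. Qed.

(** Controls the unpaired term s_0 w(-(N+1)) and shows that it tends to 0. *)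
Let w_le (N : nat) : (1 + N.+1%:R) * w (0 - N.+1%:R) <= W.
Proof.
apply: le_trans (weight_le N.+1 0); apply: ler_wpM2r => //.
rewrite lerD2l sub0r sqrrN expr2 ler_peMr ?ler0n // ler1n //.
Qed.

Section LowerBound.
Variable m : R.
Hypotheses (m_ge0 : 0 <= m) (increments_ge : forall n, - m <= s n.+1 - s n).

Section Bounded.
Variable b : R.
Hypothesis beta_le : forall N, `|beta N| <= b.

Lemma increments_bounded : exists2 K, 0 <= K & forall n, `|s n.+1 - s n| <= K.
Proof.
(* The summands come from two values of [beta], from the unpaired term, and from
   [increment_upper_bound] with eta = m. *)
pose K := (2 * b + `|s 0%N| * W + m * W) / w 0.
exists (`|K| + m) => [|n]; first by rewrite addr_ge0.
have Hc k : 0 <= s k.+1 - s k + m * (1 + (k%:R - n%:R) ^+ 2).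
  have := increments_ge k; have := mulr_ge0 m_ge0 (sqr_ge0 (k%:R - n%:R : R)); lra.
have := increment_upper_bound m_ge0 Hc.
have b1 := beta_le n.+1; have b2 := beta_le n; move: b1 b2; rewrite !ler_norml => b1 b2.
have ws : - (s 0%N * w (0 - n.+1%:R)) <= `|s 0%N| * W.
  apply: (le_trans (ler_norm _)); rewrite normrN normrM ler_wpM2l // ger0_norm //.
  have := w_le n; have := w_ge0 (0 - n.+1%:R); have : 0 <= n.+1%:R :> R by [].
  nra.
move=> H; have : s n.+1 - s n <= K.
  by rewrite /K ler_pdivlMr //; lra.
have i1 := increments_ge n; have i2 := ler_norm K; have i3 := normr_ge0 K.
move=> i4; apply/andP; split; first by lra.
by rewrite (le_trans i4) // (le_trans i2) // lerDl.
Qed.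

Lemma tauberian_bounded : exists M, forall n, `|s n| <= M.
Proof.
have [K K0 HK] := increments_bounded.
exists ((b + K * W) / w 0) => N; rewrite ler_pdivlMr //.
have Hs n : `|s n - s N| <= K * (1 + (n%:R - N%:R) ^+ 2).
  apply: (le_trans (@increments_le K 0%N (fun n _ => HK n) n N _ _)) => //.
  exact: ler_wpM2l.
by apply: (le_trans (term_bound K0 Hs)); rewrite lerD2r.
Qed.

End Bounded.

Hypothesis beta_cvg0 : beta @ \oo --> (0 : R).
Hypothesis increments_liminf : forall e, 0 < e -> \forall n \near \oo, - e <= s n.+1 - s n.

Let beta_small e : 0 < e -> \forall N \near \oo, `|beta N| <= e.
Proof.
move=> e0; have /cvgr0Pnorm_le/(_ _ e0) := beta_cvg0; exact.
Qed.

(** The lower bound -eta holds only for n >= n0. For n < n0 the bound -m is compensated by eta (n -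
    N)^2, since N - n >= m/eta + 1 makes the square at least m/eta. *)
Lemma increments_cvg0 : (fun n => s n.+1 - s n) @ \oo --> (0 : R).
Proof.
(* 2 from the two values of [beta], the next terms from the unpaired term and from the added
   weights. The final 1 gives C >= 1, so that eta <= e in the lower estimate. *)
pose C := (2 + `|s 0%N| * W + W) / w 0 + 1.
have C0 : 0 < C.
  by rewrite ltr_wpDl // divr_ge0 // ?(ltW w0_gt0) // !addr_ge0 // mulr_ge0.
apply/cvgr0Pnorm_le => e e0.
have eta0 : 0 < e / C by rewrite divr_gt0.
set eta := e / C in eta0.
have [n0 _ Hn0] := increments_liminf eta0.
near=> N.
have N0 : n0%:R + (m / eta + 1) <= N%:R.
  by near: N; exact: nbhs_infty_ger.
(* Makes the unpaired weight w(-(N+1)) at most W eta. *)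
have Ne : eta^-1 <= N%:R by near: N; exact: nbhs_infty_ger.
have Hc k : 0 <= s k.+1 - s k + eta * (1 + (k%:R - N%:R) ^+ 2).
  have [kn|nk] := leqP n0 k.
    have := Hn0 k kn; have := mulr_ge0 (ltW eta0) (sqr_ge0 (k%:R - N%:R : R)); rewrite /=; lra.
  have kn : k%:R <= n0%:R :> R by rewrite ler_nat ltnW.
  have : m / eta + 1 <= N%:R - k%:R by lra.
  have me : 0 <= m / eta by rewrite divr_ge0 // ltW.
  move=> h; have : m / eta <= (k%:R - N%:R) ^+ 2 by nra.
  rewrite ler_pdivrMr // => h2; have := increments_ge k; nra.
have := increment_upper_bound (ltW eta0) Hc.
have b1 : `|beta N.+1| <= eta.
  near: N; have [N1 _ HN1] := beta_small eta0; exists N1 => // k /= hk.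
  by apply: HN1 => /=; rewrite (leq_trans hk).
have b2 : `|beta N| <= eta by near: N; exact: beta_small.
move: b1 b2; rewrite !ler_norml => b1 b2.
have ws : - (s 0%N * w (0 - N.+1%:R)) <= `|s 0%N| * (W * eta).
  apply: (le_trans (ler_norm _)); rewrite normrN normrM ler_wpM2l // ger0_norm //.
  rewrite -ler_pdivrMr //; apply: le_trans (w_le N); rewrite mulrC ler_wpM2r //.
  by rewrite (le_trans Ne) // -natr1; lra.
move=> H; have up : s N.+1 - s N <= C * eta.
  rewrite /C mulrDl mul1r mulrAC; have : s N.+1 - s N <= (2 + `|s 0%N| * W + W) * eta / w 0.
    by rewrite ler_pdivlMr //; nra.
  lra.
have Ce : C * eta = e by rewrite /eta mulrCA divff ?mulr1 // lt0r_neq0.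
have : - eta <= s N.+1 - s N by near: N; exact: increments_liminf.
have : eta <= e.
  rewrite -Ce ler_peMl ?(ltW eta0) // lerDr divr_ge0 // ?(ltW w0_gt0) //.
  by rewrite !addr_ge0 // mulr_ge0.
by move=> *; apply/andP; split; lra.
Unshelve. all: by end_near. Qed.

(** For n >= n1 the increments are at most eta. For n < n1 only the Lipschitz constant K is
    available, but N - n >= K/eta gives K (N - n) <= eta (N - n)^2. So [term_bound] applies with a
    small eta. *)
Lemma tauberian_cvg0 : s @ \oo --> (0 : R).
Proof.
have [b Hb] : exists b, forall N, `|beta N| <= b.
  have /cvg_seq_bounded[M [_ HM]] : cvgn beta by apply/cvg_ex; exists 0.
  by exists (`|M| + 1) => N; apply: (HM (`|M| + 1)) => //; rewrite (le_lt_trans (ler_norm M)) // ltrDl.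
have [K K0 HK] := increments_bounded Hb.
pose C := (1 + W) / w 0.
have C0 : 0 < C by rewrite divr_gt0 // ltr_wpDr.
apply/cvgr0Pnorm_le => e e0.
have eta0 : 0 < e / C by rewrite divr_gt0.
set eta := e / C in eta0.
have /cvgr0Pnorm_le/(_ _ eta0)[n1 _ Hn1] := increments_cvg0.
near=> N.
have N1 : n1%:R + K / eta <= N%:R by near: N; exact: nbhs_infty_ger.
have n1N : (n1 <= N)%N by near: N; exact: nbhs_infty_ge.
have Hs n : `|s n - s N| <= eta * (1 + (n%:R - N%:R) ^+ 2).
  have [hn|hn] := leqP n1 n.
    apply: (le_trans (@increments_le eta n1 Hn1 n N hn n1N)).
    by rewrite ler_wpM2l // ltW.
  apply: (le_trans (@increments_le K 0%N (fun n _ => HK n) n N _ _)) => //.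
  have nn : n%:R <= n1%:R :> R by rewrite ler_nat ltnW.
  have Ke : 0 <= K / eta by rewrite divr_ge0 // ltW.
  have h : K / eta <= N%:R - n%:R by lra.
  rewrite distrC ger0_norm; last by lra.
  move: h; rewrite ler_pdivrMr // => h.
  have := mulr_ge0 (ltW eta0) (sqr_ge0 (n%:R - N%:R : R)).
  have : 0 <= N%:R - n%:R :> R by lra.
  nra.
have b2 : `|beta N| <= eta by near: N; exact: beta_small.
have := term_bound (ltW eta0) Hs.
have -> : e = C * eta by rewrite /eta mulrCA divff ?mulr1 // lt0r_neq0.
move=> h; rewrite /C mulrAC ler_pdivlMr //; lra.
Unshelve. all: by end_near. Qed.

End LowerBound.
End Tauberian.

(** * Boundary behavior *)

Section KernelAverages.
Context {R : realType}.
Local Notation mu := (@lebesgue_measure R).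
Variables (e : R) (phi w : R -> R).
Hypothesis K : positive_kernel e phi w.

Lemma kernel_integrable : mu.-integrable setT (EFin \o w).
Proof.
have [C C0 HC] := pk_decay K.
have I : mu.-integrable setT (EFin \o (fun x => C * (oneDsqr x)^-1)).
  exact: (integrableZl _ C oneDsqrV_integrable).
apply: le_integrable I => //.
  by apply/measurable_EFinP; exact: (continuous_measurable_fun (pk_cont K)).
move=> x _; rewrite /= lee_fin !ger0_norm ?(pk_ge0 K) //.
  apply: (le_trans (HC x)); rewrite ler_wpM2l // expr2 ler_piMl ?invr_ge0 ?addr_ge0 ?sqr_ge0 //.
  exact: oneDsqrV_le1.
by rewrite mulr_ge0 // invr_ge0 addr_ge0 ?sqr_ge0.
Qed.

Section Average.
Variables (g : R -> R) (M : R).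
Hypotheses (mg : measurable_fun setT g) (gM : forall t, `|g t| <= M).

Let mgs a : measurable_fun setT (fun t : R => g (t + a)).
Proof. by apply: measurableT_comp => //; exact: measurable_funD. Qed.

Let mw : measurable_fun setT w.
Proof. exact: (continuous_measurable_fun (pk_cont K)). Qed.

Let M0 : 0 <= M. Proof. exact: le_trans (normr_ge0 _) (gM 0). Qed.

Let iMw : mu.-integrable setT (EFin \o (fun x => M * w x)).
Proof. exact: (integrableZl _ M kernel_integrable). Qed.

Let gw_le a t : `|g (t + a) * w t| <= M * w t.
Proof. by rewrite normrM (ger0_norm (pk_ge0 K t)) ler_wpM2r // (pk_ge0 K). Qed.

Let igw a : mu.-integrable setT (EFin \o (fun t => g (t + a) * w t)).
Proof.
apply: (le_integrable measurableT _ _ iMw).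
  by apply/measurable_EFinP; exact: (measurable_funM (mgs a) mw).
move=> t _; rewrite /= lee_fin (le_trans (gw_le a t)) // ler_norm //.
Qed.

(** With the translation moved onto [g], the weight no longer depends on the centre, and M w is a
    common integrable majorant. *)
Lemma average_shift a : \int[mu]_t (g t * w (t - a)) = \int[mu]_t (g (t + a) * w t).
Proof.
pose f t := g t * w (t - a).
have E : (fun t => g (t + a) * w t) = fun t => f (t + a).
  by apply/funext => t; rewrite /f addrK.
have /= := @Rintegral_shift R f a; rewrite -E => -> //.
apply: measurable_funM => //; apply: measurableT_comp => //.
exact: measurable_funB.
Qed.

Lemma average_le a : `|\int[mu]_t (g t * w (t - a))| <= M * \int[mu]_t w t.
Proof.
rewrite average_shift -RintegralZl //; last exact: kernel_integrable.
apply: (le_trans (le_normr_Rintegral measurableT (igw a))).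
by apply: le_Rintegral => //; exact: (integrable_norm (igw a)).
Qed.

(** Dominated convergence, since g(t + N) -> 0 for each fixed t. *)
Lemma average_cvg0 : g t @[t --> +oo] --> (0 : R) ->
  (fun N => \int[mu]_t (g t * w (t - N%:R))) @ \oo --> (0 : R).
Proof.
move=> g0; under eq_fun do rewrite average_shift.
have ptw t : (g (t + N%:R) * w t)%:E @[N --> \oo] --> (0 : R)%:E.
  apply: cvg_EFin; first exact: nearW.
  rewrite -[X in _ --> X](mul0r (w t)); apply: cvgMl.
  have /cvgr0Pnorm_le h := g0; apply/cvgr0Pnorm_le => d d0.
  have [A [_ HA]] := h d d0; near=> N; apply: HA.
  have : A - t < N%:R by near: N; exact: nbhs_infty_gtr.
  lra.
have mgw (N : nat) : measurable_fun [set: measurableTypeR R]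
    (fun t : measurableTypeR R => (g (t + N%:R) * w t)%:E).
  by apply/measurable_EFinP; exact: (measurable_funM (@mgs N%:R) mw).
have lim0 : {ae mu, forall t : measurableTypeR R, [set: measurableTypeR R] t ->
    (g (t + N%:R) * w t)%:E @[N --> \oo] --> 0%E}.
  by apply: aeW => t _; exact: ptw.
have dom : {ae mu, forall (t : measurableTypeR R) (N : nat), [set: measurableTypeR R] t ->
    (`|(g (t + N%:R) * w t)%R%:E| <= (EFin \o (fun x : R => (M * w x)%R)) t)%E}.
  by apply: aeW => t N _; rewrite lee_fin gw_le.
have [_ _ H] := @dominated_convergence _ (measurableTypeR R) R mu setT measurableT _ (cst 0%E) _
  mgw (measurable_cst _) lim0 iMw dom.
by move: H; rewrite integral0 => H; apply: fine_cvg; exact: H.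
Unshelve. all: by end_near. Qed.

End Average.
End KernelAverages.

(** * Complex limits through real and imaginary parts *)

Section ComplexLimits.
Context {R : realType}.
Local Notation Re := (@complex.Re R).
Local Notation Im := (@complex.Im R).

Lemma Re_add (x y : R[i]) : Re (x + y) = Re x + Re y. Proof. by case: x y => ? ? []. Qed.
Lemma Im_add (x y : R[i]) : Im (x + y) = Im x + Im y. Proof. by case: x y => ? ? []. Qed.
Lemma Re_opp (x : R[i]) : Re (- x) = - Re x. Proof. by case: x. Qed.
Lemma Im_opp (x : R[i]) : Im (- x) = - Im x. Proof. by case: x. Qed.
Lemma Re_mul (x y : R[i]) : Re (x * y) = Re x * Re y - Im x * Im y.
Proof. by case: x y => ? ? []. Qed.
Lemma Im_mul (x y : R[i]) : Im (x * y) = Re x * Im y + Im x * Re y.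
Proof. by case: x y => ? ? []. Qed.

Lemma Re_sum (I : Type) (r : seq I) (F : I -> R[i]) :
  Re (\sum_(i <- r) F i) = \sum_(i <- r) Re (F i).
Proof. by apply: (big_morph _ Re_add). Qed.
Lemma Im_sum (I : Type) (r : seq I) (F : I -> R[i]) :
  Im (\sum_(i <- r) F i) = \sum_(i <- r) Im (F i).
Proof. by apply: (big_morph _ Im_add). Qed.

Lemma norm_Re_Im_le (z : R[i]) (x : R) : `|z| <= x%:C%C -> `|Re z| <= x /\ `|Im z| <= x.
Proof.
rewrite normc_def lecR => h; split; apply: le_trans h.
  by rewrite -sqrtr_sqr ler_sqrt ?addr_ge0 ?sqr_ge0 // lerDl sqr_ge0.
by rewrite -sqrtr_sqr ler_sqrt ?addr_ge0 ?sqr_ge0 // lerDr sqr_ge0.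
Qed.

Lemma cvg_ReIm (T : Type) (F : set_system T) (FF : Filter F) (f : T -> Cx R) (l : Cx R) :
  f @ F --> l ->
  (fun x => Re (f x)) @ F --> Re l /\ (fun x => Im (f x)) @ F --> Im l.
Proof.
move=> /cvgrPdist_le H; split; apply/cvgrPdist_le => d d0.
  have : 0 < d%:C%C :> R[i] by rewrite ltcR.
  move=> /H; apply: filterS => x /norm_Re_Im_le[h _].
  by move: h; rewrite Re_add Re_opp.
have : 0 < d%:C%C :> R[i] by rewrite ltcR.
move=> /H; apply: filterS => x /norm_Re_Im_le[_ h].
by move: h; rewrite Im_add Im_opp.
Qed.

Lemma cvg_realC (T : Type) (F : set_system T) (FF : Filter F) (f : T -> R) (l : R) :
  f @ F --> l -> (fun x => (f x)%:C%C : Cx R) @ F --> (l%:C%C : Cx R).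
Proof.
move=> /cvgrPdist_le H; apply/cvgrPdist_le => -[d d'] d0.
(* Radii live in [R[i]], where being positive forces the imaginary part to be 0. *)
have [d00 dE] : 0 < d /\ d' = 0 by move: d0; rewrite ltcE /= => /andP[/eqP ? ?].
move: (H _ d00); apply: filterS => x h.
rewrite -rmorphB normc_def /= expr0n /= addr0 sqrtr_sqr dE.
by rewrite lecR.
Qed.

Lemma expiD (a b : R) : expi (a + b) = expi a * expi b.
Proof.
by rewrite /expi cosD sinD [sin a * _ + _]addrC.
Qed.

Lemma expiX (a : R) n : expi a ^+ n = expi (n%:R * a).
Proof.
elim: n => [|n IH]; first by rewrite expr0 mul0r /expi cos0 sin0.
by rewrite exprS IH -expiD -natr1 mulrDl mul1r addrC.
Qed.

Lemma norm_expi (a : R) : `|expi a| = 1 :> R[i].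
Proof. by rewrite /expi normc_def /= cos2Dsin2 sqrtr1. Qed.

End ComplexLimits.

(** * Termwise integration of trigonometric series *)

Section TrigonometricSeries.
Context {R : realType}.
Local Notation mu := (@lebesgue_measure R).
Variables (e : R) (phi w : R -> R).
Hypothesis K : positive_kernel e phi w.

Lemma geometric_sum_le (sigma : R) M : 0 <= sigma -> sigma < 1 ->
  \sum_(n < M) sigma ^+ n <= (1 - sigma)^-1.
Proof.
move=> s0 s1; have p : 0 < 1 - sigma by lra.
rewrite -[leRHS]mul1r ler_pdivlMr //.
elim: M => [|M IH]; first by rewrite big_ord0 mul0r.
suff E k : (\sum_(n < k) sigma ^+ n) * (1 - sigma) = 1 - sigma ^+ k.
  by rewrite E lerBlDr lerDl exprn_ge0.
elim: k => [|k IHk]; first by rewrite big_ord0 mul0r expr0 subrr.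
by rewrite big_ord_recr /= mulrDl IHk exprS; ring.
Qed.

(** The geometric bounds give a majorant, a constant times |phi|, for all partial sums, so integral
    and limit may be exchanged. The coefficients [b] disappear because the sine transform of [phi]
    is 0. *)
Lemma integral_trigonometric_series (a b : nat -> R) (D sigma : R) (N : R) (f : R -> R) :
  0 <= sigma -> sigma < 1 ->
  (forall n, `|a n| <= D * sigma ^+ n) -> (forall n, `|b n| <= D * sigma ^+ n) ->
  (forall x, \sum_(n < M) (a n * cos ((n%:R - N) * x) + b n * sin ((n%:R - N) * x)) * phi x
      @[M --> \oo] --> f x) ->
  series (fun n => a n * w (n%:R - N)) @ \oo --> \int[mu]_x f x.
Proof.
move=> s0 s1 Ha Hb Hf.
have cphi := smooth_continuous (pk_smooth K).
have csphi : compactly_supported phi by exists (e / 2); exact: (pk_support K).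
pose fM M (x : R) :=
  \sum_(n < M) (a n * cos ((n%:R - N) * x) + b n * sin ((n%:R - N) * x)) * phi x.
have icos t := integrable_smoothM (smooth_continuous (@smooth_cosM R t)) cphi csphi.
have isin t := integrable_smoothM (smooth_continuous (@smooth_sinM R t)) cphi csphi.
have iterm n : mu.-integrable setT (EFin \o (fun x =>
    (a n * cos ((n%:R - N) * x) + b n * sin ((n%:R - N) * x)) * phi x)).
  have := integrableD measurableT (integrableZl measurableT (a n) (icos (n%:R - N)))
    (integrableZl measurableT (b n) (isin (n%:R - N))).
  apply: eq_integrable => // x _.
  by rewrite /= -EFinM -EFinM -EFinD; congr EFin; ring.
have Eterm n : \int[mu]_x ((a n * cos ((n%:R - N) * x) + b n * sin ((n%:R - N) * x)) * phi x) =
    a n * w (n%:R - N).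
  rewrite (_ : (fun x => _) = fun x => a n * (cos ((n%:R - N) * x) * phi x) +
     b n * (sin ((n%:R - N) * x) * phi x)); last by apply/funext => x; ring.
  rewrite Rintegral_lin //.
  have := pk_cos K (n%:R - N); have := pk_sin K (n%:R - N).
  by rewrite /cos_transform /sin_transform => -> ->; rewrite mulr0 addr0.
have ifM M : mu.-integrable setT (EFin \o fM M) /\
    \int[mu]_x fM M x = \sum_(n < M) a n * w (n%:R - N).
  elim: M => [|M [IH1 IH2]].
    rewrite big_ord0 (_ : fM 0%N = fun=> 0).
      split; first exact: integrable0.
      by rewrite /Rintegral integral0.
    by apply/funext => x; rewrite /fM big_ord0.
  rewrite (_ : fM M.+1 = fun x => fM M x +
      (a M * cos ((M%:R - N) * x) + b M * sin ((M%:R - N) * x)) * phi x); last first.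
    by apply/funext => x; rewrite /fM big_ord_recr.
  split; first exact: (integrableD measurableT IH1 (iterm M)).
  by rewrite RintegralD // IH2 Eterm big_ord_recr.
pose C := 2 * D / (1 - sigma).
have D0 : 0 <= D by have := le_trans (normr_ge0 _) (Ha 0%N); rewrite expr0 mulr1.
have fMC M x : `|fM M x| <= C * `|phi x|.
  rewrite /fM -mulr_suml normrM ler_wpM2r //.
  apply: (le_trans (ler_norm_sum _ _ _)).
  apply: (@le_trans _ _ (\sum_(n < M) (2 * D) * sigma ^+ n)).
    apply: ler_sum => n _; apply: (le_trans (ler_normD _ _)).
    rewrite (_ : 2 * D * _ = D * sigma ^+ n + D * sigma ^+ n); last by ring.
    rewrite !normrM; apply: lerD.
      by apply: le_trans (Ha n); rewrite ler_piMr // cos_max.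
    by apply: le_trans (Hb n); rewrite ler_piMr // sin_max.
  by rewrite -mulr_sumr ler_wpM2l ?mulr_ge0 // geometric_sum_le.
have mfM M : measurable_fun [set: measurableTypeR R] (EFin \o fM M : measurableTypeR R -> \bar R).
  by have /integrableP[] := (ifM M).1.
have lim : forall x : measurableTypeR R, [set: measurableTypeR R] x ->
    (EFin \o fM M) x @[M --> \oo] --> (f x)%:E.
  by move=> x _; apply: cvg_EFin; [exact: nearW|exact: Hf].
have mf : measurable_fun [set: measurableTypeR R] (EFin \o f : measurableTypeR R -> \bar R).
  exact: (emeasurable_fun_cvg _ _ mfM lim).
have iC : mu.-integrable setT (EFin \o (fun x => C * `|phi x|)).
  exact: (integrableZl measurableT C
    (integrable_norm (integrable_compactly_supported cphi csphi))).
have dom : {ae mu, forall (x : measurableTypeR R) (M : nat), [set: measurableTypeR R] x ->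
    (`|(EFin \o fM M) x| <= (EFin \o (fun x : R => (C * `|phi x|)%R)) x)%E}.
  by apply: aeW => x M _; rewrite /= lee_fin fMC.
have [If _ H] := @dominated_convergence _ (measurableTypeR R) R mu setT measurableT
  (fun M => EFin \o fM M) (EFin \o f) _ mfM mf (aeW _ lim) iC dom.
have H2 : (fun M => (series (fun n => a n * w (n%:R - N)) M)%:E) @ \oo --> (\int[mu]_x f x)%:E.
  rewrite (EFin_Rintegral If) (_ : (fun M => _) = (fun M => \int[mu]_x (fM M x)%:E)%E).
    exact: H.
  by apply/funext => M; rewrite -(EFin_Rintegral (ifM M).1) (ifM M).2 /series /= big_mkord.
exact: (fine_cvg H2).
Qed.

End TrigonometricSeries.

(** * Partial sums of the coefficients inside the disc *)

Section PowerSeries.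
Context {R : realType}.
Variable c : nat -> R.
Hypothesis c_cvg : forall z : Cx R, `|z| < 1 ->
  cvgn (series (fun n => ((c n)%:C%C : Cx R) * z ^+ n)).
Variable F1 : Cx R.

Lemma coef_bounded (rho : R) : 0 < rho < 1 ->
  exists2 C, 0 <= C & forall n, `|c n| * rho ^+ n <= C.
Proof.
move=> /andP[r0 r1].
have nz : `|(rho%:C%C : Cx R)| < 1.
  by rewrite normc_def /= expr0n /= addr0 sqrtr_sqr gtr0_norm // ltcR.
have /cvg_ReIm[h _] := cvg_series_cvg_0 (c_cvg nz).
have {}h : (fun n => c n * rho ^+ n) @ \oo --> (0 : R).
  rewrite (_ : (fun n => _) = fun n => complex.Re ((c n)%:C%C * rho%:C%C ^+ n : R[i])).
    exact: h.
  by apply/funext => n; rewrite -rmorphXn -rmorphM.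
have /cvg_seq_bounded[M [_ HM]] : cvgn (fun n => c n * rho ^+ n) by apply/cvg_ex; exists 0.
exists (`|M| + 1) => [|n]; first by rewrite addr_ge0.
rewrite -[rho ^+ n]ger0_norm ?exprn_ge0 ?(ltW r0) // -normrM.
by apply: (HM (`|M| + 1)) => //; rewrite (le_lt_trans (ler_norm M)) // ltrDl.
Qed.

(** With rho halfway between r and 1, the partial sums grow at most like rho^-n, whence the ratio
    sigma = r / rho < 1. The clause r <= sigma lets the same ratio dominate the constant F(1) times
    r^n. *)
Lemma partial_sums_bounded (r : R) : 0 < r < 1 ->
  exists D sigma : R, [/\ 0 <= D, 0 <= sigma, sigma < 1, r <= sigma &
    forall n, `|\sum_(k < n) c k| * r ^+ n <= D * sigma ^+ n].
Proof.
move=> /andP[r0 r1]; pose rho := (1 + r) / 2.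
have rho0 : 0 < rho by rewrite /rho; lra.
have rho1 : rho < 1 by rewrite /rho; lra.
have rrho : r < rho by rewrite /rho; lra.
have [C C0 HC] : exists2 C, 0 <= C & forall n, `|c n| * rho ^+ n <= C.
  by apply: coef_bounded; rewrite rho0 rho1.
have p : 0 < 1 - rho by lra.
have Q n : `|\sum_(k < n) c k| * rho ^+ n <= C / (1 - rho).
  elim: n => [|n IH]; first by rewrite big_ord0 normr0 mul0r divr_ge0 // ltW.
  rewrite big_ord_recr /=.
  apply: (@le_trans _ _ (rho * (`|\sum_(k < n) c k| * rho ^+ n) + rho * (`|c n| * rho ^+ n))).
    rewrite -mulrDr -mulrDl exprS mulrCA ler_wpM2l ?(ltW rho0) // ler_wpM2r ?exprn_ge0 ?(ltW rho0) //.
    exact: ler_normD.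
  (* C / (1 - rho) is the fixed point of x -> rho x + C, so the induction reproduces it. *)
  have E : C / (1 - rho) = rho * (C / (1 - rho)) + C by field; rewrite gt_eqF.
  rewrite [leRHS]E; apply: lerD; first by rewrite ler_wpM2l // ltW.
  by apply: (le_trans _ (HC n)); rewrite ler_piMl ?(ltW rho1) // mulr_ge0 // exprn_ge0 // ltW.
exists (C / (1 - rho)), (r / rho); split.
- by rewrite divr_ge0 // ltW.
- by rewrite divr_ge0 // ltW.
- by rewrite ltr_pdivrMr // mul1r.
- by rewrite ler_pdivlMr // ler_piMr // ltW.
move=> n; rewrite expr_div_n mulrA ler_pdivlMr ?exprn_gt0 // mulrAC.
by rewrite ler_wpM2r // exprn_ge0 // ltW.
Qed.

(** The sum stops before index n: [remainder n.+1] is the s_n of the overview, and [remainder 0] is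
    -F(1). *)
Definition remainder (n : nat) : Cx R := ((\sum_(k < n) c k)%:C%C : Cx R) - F1.

(** Summation by parts in finite form, with its boundary term kept. *)
Lemma remainder_recurrence (z : Cx R) M :
  (1 - z) * \sum_(n < M) remainder n.+1 * z ^+ n =
  series (fun n => ((c n)%:C%C : Cx R) * z ^+ n) M - F1 - remainder M * z ^+ M.
Proof.
elim: M => [|M IH].
  by rewrite big_ord0 mulr0 /series /= big_geq // /remainder big_ord0 expr0 mulr1 subrr.
rewrite big_ord_recr /= mulrDr IH /series /= big_nat_recr //=.
have -> : remainder M.+1 = remainder M + ((c M)%:C%C : Cx R).
  by rewrite /remainder big_ord_recr /= rmorphD addrAC.
by rewrite exprS; ring.
Qed.

Lemma cvg0_le_real (f : nat -> Cx R) (b : nat -> R) :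
  b @ \oo --> (0 : R) -> (forall n, `|f n| <= ((b n)%:C%C : R[i])) -> f @ \oo --> (0 : Cx R).
Proof.
move=> /cvgr0Pnorm_le H fb; apply/cvgr0Pnorm_le => -[d d'] d0.
have [d00 dE] : 0 < d /\ d' = 0 by move: d0; rewrite ltcE /= => /andP[/eqP ? ?].
move: (H _ d00); apply: filterS => n h; apply: (le_trans (fb n)).
by rewrite dE lecR (le_trans (ler_norm _)).
Qed.

(** Division of the finite identity by 1 - z; its boundary term decays geometrically by
    [partial_sums_bounded]. *)
Lemma remainder_series_cvg (r theta : R) : 0 < r < 1 ->
  let z : Cx R := (r%:C%C : Cx R) * expi theta in
  (fun M => \sum_(n < M) remainder n.+1 * z ^+ n) @ \oo --> - ((psum c z - F1) / (z - 1)).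
Proof.
move=> r01 z; have /andP[r0 r1] := r01.
have nz : `|z| = (r%:C%C : R[i]).
  by rewrite normrM norm_expi mulr1 normc_def /= expr0n /= addr0 sqrtr_sqr gtr0_norm.
have z1 : `|z| < 1 by rewrite nz ltcR.
have z1n : 1 - z != 0.
  by apply: contraTneq z1 => /eqP; rewrite subr_eq0 => /eqP <-; rewrite normr1 ltxx.
have [D [sigma [D0 s0 s1 rs HD]]] := partial_sums_bounded r01.
pose f1 : R := Num.sqrt (complex.Re (F1 : R[i]) ^+ 2 + complex.Im (F1 : R[i]) ^+ 2).
have rem0 : (fun M => remainder M * z ^+ M) @ \oo --> (0 : Cx R).
  apply: (@cvg0_le_real _ (fun M => (D + f1) * sigma ^+ M)).
    rewrite -(mulr0 (D + f1)); apply: cvgMr; apply: cvg_expr.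
    by rewrite ger0_norm.
  move=> M; rewrite normrM normrX nz -rmorphXn.
  apply: (@le_trans _ _ ((`|\sum_(k < M) c k| + f1)%:C%C * (r ^+ M)%:C%C)).
    apply: ler_wpM2r; first by rewrite ler0c exprn_ge0 // ltW.
    apply: (le_trans (ler_normB _ _)); rewrite rmorphD; apply: lerD.
      by rewrite normc_def /= expr0n /= addr0 sqrtr_sqr.
    by rewrite normc_def.
  rewrite -rmorphM lecR mulrDl mulrDl lerD // ler_wpM2l ?sqrtr_ge0 //.
  by rewrite lerXn2r ?nnegrE // ltW.
have A := c_cvg z1.
have -> : - ((psum c z - F1) / (z - 1)) = (1 - z)^-1 * (psum c z - F1 - 0).
  by rewrite subr0 -mulrN -invrN opprB mulrC.
rewrite (_ : (fun M => _) = fun M => (1 - z)^-1 *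
   (series (fun n => ((c n)%:C%C : Cx R) * z ^+ n) M - F1 - remainder M * z ^+ M)).
  pose u M : Cx R := series (fun n => ((c n)%:C%C : Cx R) * z ^+ n) M - F1 - remainder M * z ^+ M.
  have L : u @ \oo --> psum c z - F1 - 0.
    exact: (cvgB (cvgB A (cvg_cst F1)) rem0).
  exact: (cvgM (cvg_cst ((1 - z)^-1)) L).
by apply/funext => M; rewrite -remainder_recurrence mulKf.
Qed.

End PowerSeries.

(** * Boundary behavior tested on modulated kernels *)

Section BoundaryBehavior.
Context {R : realType}.
Local Notation mu := (@lebesgue_measure R).
Variables (e : R) (phi w : R -> R).
Hypotheses (e_gt0 : 0 < e) (K : positive_kernel e phi w).

Definition modulation (N : nat) (x : R) : Cx R :=
  expi (- (N%:R * x)) * ((phi x)%:C%C : Cx R).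

Lemma test_fun_modulation N (a b : R) : a <= - e -> e <= b -> test_fun a b (modulation N).
Proof.
move=> ae eb; have e0 := e_gt0; split; last split.
- rewrite (_ : (fun x => _) = fun x => cos (- N%:R * x) * phi x).
    by apply: smoothM; [exact: smooth_cosM|exact: (pk_smooth K)].
  by apply/funext => x; rewrite Re_mul /= mulr0 subr0 mulNr.
- rewrite (_ : (fun x => _) = fun x => sin (- N%:R * x) * phi x).
    by apply: smoothM; [exact: smooth_sinM|exact: (pk_smooth K)].
  by apply/funext => x; rewrite Im_mul /= mulr0 add0r mulNr.
exists (- (e / 2)), (e / 2); split; first lra; split; first lra.
move=> x hx; rewrite /modulation (pk_support K) ?mulr0 //.
by case: hx => hx; rewrite ler_normr; apply/orP; [right|left]; lra.
Qed.

Lemma fourier_modulation N t : fourier (modulation N) (- t) = (w (t - N%:R))%:C%C.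
Proof.
have E x : expi (- (- t * x)) * modulation N x =
    expi ((t - N%:R) * x) * ((phi x)%:C%C : Cx R).
  by rewrite mulrA -expiD; congr (expi _ * _); ring.
have -> : fourier (modulation N) (- t) =
    Cint (fun x => expi ((t - N%:R) * x) * ((phi x)%:C%C : Cx R)).
  by rewrite /fourier; congr Cint; apply/funext => x; rewrite E.
have -> : (w (t - N%:R))%:C%C =
    Complex (cos_transform phi (t - N%:R)) (sin_transform phi (t - N%:R)).
  by rewrite (pk_cos K) (pk_sin K).
rewrite /Cint.
congr Complex; apply: eq_Rintegral => x _.
  by rewrite Re_mul /= mulr0 subr0.
by rewrite Im_mul /= mulr0 add0r.
Qed.

(** Modulation by e^(-iNx) recentres the transform at N: the action is an average of [G] around N,
    which sees only the size of [G] there as N grows. *)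
Lemma inv_fourier_action_modulation (G : R -> Cx R) N :
  complex.Re (inv_fourier_action G (modulation N) : R[i]) =
    (2 * pi)^-1 * \int[mu]_t (complex.Re (G t : R[i]) * w (t - N%:R)) /\
  complex.Im (inv_fourier_action G (modulation N) : R[i]) =
    (2 * pi)^-1 * \int[mu]_t (complex.Im (G t : R[i]) * w (t - N%:R)).
Proof.
rewrite /inv_fourier_action Re_mul Im_mul /= !mul0r subr0 addr0.
by split; congr (_ * _); apply: eq_Rintegral => t _;
  rewrite fourier_modulation ?Re_mul ?Im_mul /= !mulr0 ?subr0 ?add0r.
Qed.

Lemma Linf_fun_Re_Im (G : R -> Cx R) : Linf_fun G -> exists M : R,
  [/\ measurable_fun setT (fun t => complex.Re (G t : R[i])),
   measurable_fun setT (fun t => complex.Im (G t : R[i])),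
   forall t, `|complex.Re (G t : R[i])| <= M & forall t, `|complex.Im (G t : R[i])| <= M].
Proof.
move=> [m1 [m2 [M HM]]]; exists M; split => // t.
  by have [] := norm_Re_Im_le (HM t).
by have [] := norm_Re_Im_le (HM t).
Qed.

Lemma action_bounded (G : R -> Cx R) : Linf_fun G -> exists b, forall N,
  `|complex.Re (inv_fourier_action G (modulation N) : R[i])| <= b.
Proof.
move=> /Linf_fun_Re_Im[M [m1 _ M1 _]].
exists ((2 * pi)^-1 * (M * \int[mu]_t w t)) => N.
have [-> _] := inv_fourier_action_modulation G N.
have p : 0 <= (2 * pi)^-1 :> R by rewrite invr_ge0 mulr_ge0 // pi_ge0.
by rewrite normrM (ger0_norm p) ler_wpM2l // (average_le K).
Qed.

Lemma action_cvg0 (G : R -> Cx R) : vanishing_Linf_fun G ->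
  (fun N => complex.Re (inv_fourier_action G (modulation N) : R[i])) @ \oo --> (0 : R) /\
  (fun N => complex.Im (inv_fourier_action G (modulation N) : R[i])) @ \oo --> (0 : R).
Proof.
move=> [/Linf_fun_Re_Im[M [m1 m2 M1 M2]] [Gy _]].
have /cvg_ReIm[/= R0 I0] := Gy.
split.
  rewrite (_ : (fun N => _) =
      fun N => (2 * pi)^-1 * \int[mu]_t (complex.Re (G t : R[i]) * w (t - N%:R))).
    by rewrite -(mulr0 (2 * pi)^-1); apply: cvgMr; exact: (average_cvg0 K m1 M1 R0).
  by apply/funext => N; have [] := inv_fourier_action_modulation G N.
rewrite (_ : (fun N => _) =
    fun N => (2 * pi)^-1 * \int[mu]_t (complex.Im (G t : R[i]) * w (t - N%:R))).
  by rewrite -(mulr0 (2 * pi)^-1); apply: cvgMr; exact: (average_cvg0 K m2 M2 I0).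
by apply/funext => N; have [] := inv_fourier_action_modulation G N.
Qed.

(** Here the decay t^-4 is spent: one factor 1 / (1 + x^2) absorbs the weight, the other is
    summed. *)
Lemma kernel_sum_bounded : exists W, forall M N : nat,
  \sum_(n < M) (1 + (n%:R - N%:R) ^+ 2) * w (n%:R - N%:R) <= W.
Proof.
have [C C0 HC] := pk_decay K; exists (C * 8) => M N.
apply: le_trans (ler_wpM2l C0 (sum_oneDsqrV_le M N)).
rewrite mulr_sumr; apply: ler_sum => n _.
move: (n%:R - N%:R) => x; have := HC x; rewrite /oneDsqr.
have p : 0 < 1 + x ^+ 2 by rewrite ltr_pwDl ?sqr_ge0.
rewrite exprVn ler_pdivlMr ?exprn_gt0 // => h.
by rewrite ler_pdivlMr // (_ : _ * _ * _ = w x * (1 + x ^+ 2) ^+ 2) //; ring.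
Qed.

Section Coefficients.
Variable c : nat -> R.
Hypothesis c_cvg : forall z : Cx R, `|z| < 1 ->
  cvgn (series (fun n => ((c n)%:C%C : Cx R) * z ^+ n)).
Variable F1 : Cx R.

(** The pairing at radius r whose limit the boundary behavior supplies; up to sign, its parts are
    the sums [B N r] of the sequence argument. *)
Definition smeared (N : nat) (r : R) : Cx R :=
  Cint (fun th => (psum c ((r%:C%C : Cx R) * expi th) - F1) /
    ((r%:C%C : Cx R) * expi th - 1) * modulation N th).

Lemma Re_Im_term (q : R[i]) (r x N : R) (n : nat) (p : R) :
  complex.Re (q * ((r%:C%C * expi x) ^+ n) * (expi (- (N * x)) * p%:C%C)) =
   (complex.Re q * r ^+ n * cos ((n%:R - N) * x) + - complex.Im q * r ^+ n * sin ((n%:R - N) * x)) * p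
  /\
  complex.Im (q * ((r%:C%C * expi x) ^+ n) * (expi (- (N * x)) * p%:C%C)) =
   (complex.Im q * r ^+ n * cos ((n%:R - N) * x) + complex.Re q * r ^+ n * sin ((n%:R - N) * x)) * p.
Proof.
have -> : q * ((r%:C%C * expi x) ^+ n) * (expi (- (N * x)) * p%:C%C) =
   q * (r ^+ n)%:C%C * expi ((n%:R - N) * x) * p%:C%C.
  have <- : expi x ^+ n * expi (- (N * x)) = expi ((n%:R - N) * x).
    by rewrite expiX -expiD; congr expi; ring.
  by rewrite exprMn rmorphXn /=; ring.
by rewrite !(Re_mul, Im_mul) /=; split; ring.
Qed.

(** The remainder series is integrated term by term against the modulated kernel, its real and
    imaginary parts apart. *)
Lemma smeared_series (N : nat) (r : R) : 0 < r < 1 ->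
  series (fun n => complex.Re (remainder c F1 n.+1 : R[i]) * r ^+ n * w (n%:R - N%:R)) @ \oo -->
    - complex.Re (smeared N r : R[i]) /\
  series (fun n => complex.Im (remainder c F1 n.+1 : R[i]) * r ^+ n * w (n%:R - N%:R)) @ \oo -->
    - complex.Im (smeared N r : R[i]).
Proof.
move=> r01; have /andP[r0 r1] := r01.
have [D [sigma [D0 s0 s1 rs HD]]] := partial_sums_bounded c_cvg r01.
pose q n : R[i] := remainder c F1 n.+1.
pose E := `|complex.Re (F1 : R[i])| + `|complex.Im (F1 : R[i])|.
have E0 : 0 <= E by rewrite addr_ge0.
have sn n : 0 <= sigma ^+ n by rewrite exprn_ge0.
have rn n : 0 <= r ^+ n by rewrite exprn_ge0 // ltW.
have rsn n : r ^+ n <= sigma ^+ n by rewrite lerXn2r ?nnegrE // ltW.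
(* The partial sum up to n is controlled with r^(n+1), hence the factor sigma / r; [E] accounts for
   F(1). *)
have bound n x : `|x| <= `|\sum_(k < n.+1) c k| + E -> `|x * r ^+ n| <= (D * sigma / r + E) * sigma ^+ n.
  move=> hx; rewrite normrM (ger0_norm (rn n)).
  apply: (le_trans (ler_wpM2r (rn n) hx)); rewrite mulrDl [leRHS]mulrDl; apply: lerD; last exact: ler_wpM2l.
  have := HD n.+1; rewrite !exprS => h.
  by rewrite -mulrA [r^-1 * _]mulrC mulrA ler_pdivlMr // -!mulrA [r ^+ n * r]mulrC.
have bRe n : `|complex.Re (q n)| <= `|\sum_(k < n.+1) c k| + E.
  rewrite /q /remainder Re_add Re_opp /=; apply: (le_trans (ler_normB _ _)).
  by rewrite lerD2l lerDl.
have bIm n : `|complex.Im (q n)| <= `|\sum_(k < n.+1) c k| + E.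
  rewrite /q /remainder Im_add Im_opp /= sub0r normrN.
  by apply: ler_wpDl => //; rewrite lerDr.
have ptw x := @remainder_series_cvg R c c_cvg F1 r x r01.
pose f x : R[i] := (psum c ((r%:C%C : Cx R) * expi x) - F1) /
  ((r%:C%C : Cx R) * expi x - 1) * modulation N x.
have prod x : (fun M => \sum_(n < M) - q n * ((r%:C%C * expi x) ^+ n) * modulation N x : Cx R)
    @ \oo --> (f x : Cx R).
  rewrite (_ : (fun M => _) = fun M =>
    (- \sum_(n < M) remainder c F1 n.+1 * ((r%:C%C : Cx R) * expi x) ^+ n) * modulation N x).
    have := cvgM (cvgN (ptw x)) (cvg_cst (modulation N x)).
    rewrite opprK => h; exact: h.
  apply/funext => M; rewrite -sumrN mulr_suml; apply: eq_bigr => n _.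
  by rewrite mulNr.
have neg (u : nat -> R) (l : R) : series (fun n => - u n * r ^+ n * w (n%:R - N%:R)) @ \oo --> l ->
    series (fun n => u n * r ^+ n * w (n%:R - N%:R)) @ \oo --> - l.
  move=> h; rewrite (_ : series _ = fun M => - series (fun n => - u n * r ^+ n * w (n%:R - N%:R)) M).
    exact: (cvgN h).
  apply/funext => M; rewrite /series /= -sumrN; apply: eq_bigr => n _.
  by rewrite !mulNr opprK.
split; apply: neg.
(* The coefficients are -q_n, since (F - F(1)) / (z - 1) is minus the remainder series; [neg] has
   moved that sign to the limit. *)
- apply: (@integral_trigonometric_series R e phi w K _
    (fun n => complex.Im (q n) * r ^+ n) (D * sigma / r + E) sigma N%:R
    (fun x => complex.Re (f x)) s0 s1) => [n|n|x]; last 1 first.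
  + have /cvg_ReIm[h _] := prod x.
    rewrite (_ : (fun M => _) = fun M => complex.Re
      (\sum_(n < M) - q n * ((r%:C%C * expi x) ^+ n) * modulation N x : R[i])); first exact: h.
    apply/funext => M; rewrite Re_sum; apply: eq_bigr => n _.
    by rewrite (Re_Im_term _ _ _ _ _ _).1 Re_opp Im_opp opprK.
  + by apply: bound; rewrite normrN; exact: bRe.
  + by apply: bound; exact: bIm.
- apply: (@integral_trigonometric_series R e phi w K _
    (fun n => - complex.Re (q n) * r ^+ n) (D * sigma / r + E) sigma N%:R
    (fun x => complex.Im (f x)) s0 s1) => [n|n|x]; last 1 first.
  + have /cvg_ReIm[_ h] := prod x.
    rewrite (_ : (fun M => _) = fun M => complex.Im
      (\sum_(n < M) - q n * ((r%:C%C * expi x) ^+ n) * modulation N x : R[i])); first exact: h.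
    apply/funext => M; rewrite Im_sum; apply: eq_bigr => n _.
    by rewrite (Re_Im_term _ _ _ _ _ _).2 Re_opp Im_opp.
  + by apply: bound; rewrite normrN; exact: bIm.
  + by apply: bound; rewrite normrN; exact: bRe.
Qed.

Lemma smeared_cvg_action (T : (R -> Cx R) -> Cx R) :
  (forall f, test_fun (- e) e f ->
     Cint (fun th => (psum c ((r%:C%C : Cx R) * expi th) - F1) /
       ((r%:C%C : Cx R) * expi th - 1) * f th) @[r --> (1 : R)^'-] --> T f) ->
  forall N, - complex.Re (smeared N r : R[i]) @[r --> (1 : R)^'-] -->
      - complex.Re (T (modulation N) : R[i]) /\
    - complex.Im (smeared N r : R[i]) @[r --> (1 : R)^'-] -->
      - complex.Im (T (modulation N) : R[i]).
Proof.
move=> HT N; have /cvg_ReIm[h1 h2] := HT _ (@test_fun_modulation N _ _ (lexx _) (lexx _)).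
by split; [exact: (cvgN h1)|exact: (cvgN h2)].
Qed.

End Coefficients.
End BoundaryBehavior.

(** * From boundary behavior to the partial sums *)

Lemma limn_einf_ge0 (R : realType) (c : nat -> R) :
  (0 <= limn_einf (fun n => (c n)%:E))%E ->
  forall d, 0 < d -> \forall n \near \oo, - d <= c n.
Proof.
rewrite limn_einf_lim => h d d0.
have lt : ((- d)%:E < limn (einfs (fun n => (c n)%:E)))%E.
  by apply: lt_le_trans h; rewrite lte_fin oppr_lt0.
have := lte_lim (@nondecreasing_einfs R (fun n => (c n)%:E)) (@is_cvg_einfs R (fun n => (c n)%:E)) lt.
apply: filterS => n hn; rewrite -lee_fin; apply: (le_trans hn).
by apply: ereal_inf_lbound; exists n => /=.
Qed.

Lemma cvg_complex_of_ReIm (R : realType) (f : nat -> Cx R) (l : Cx R) :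
  (fun n => complex.Re (f n : R[i])) @ \oo --> complex.Re (l : R[i]) ->
  (fun n => complex.Im (f n : R[i])) @ \oo --> complex.Im (l : R[i]) ->
  f @ \oo --> l.
Proof.
move=> h1 h2.
have E (z : R[i]) : z = (complex.Re z)%:C%C + 'i%C * (complex.Im z)%:C%C by exact: complexE.
rewrite (E l) (_ : f = fun n => (complex.Re (f n : R[i]))%:C%C +
    'i%C * (complex.Im (f n : R[i]))%:C%C); last by apply/funext => n; exact: E.
exact: (cvgD (cvg_realC _ h1) (cvgM (cvg_cst ('i%C : Cx R)) (cvg_realC _ h2))).
Qed.

Unset Implicit Arguments.

Theorem theorem6p2 (R : realType) (c : nat -> R) :
  (* F(z) = \sum c_n z^n is analytic on the unit disc *)
  (forall z : Cx R, `|z| < 1 ->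
     cvgn (series (fun n => ((c n)%:C%C : Cx R) * z ^+ n))) ->
  (* (i) *)
  ((exists m : R, forall n, m <= c n) ->
   pseudomeasure_bb (fun z : Cx R => psum c z / (z - 1)) 0 ->
   exists M : R, forall N : nat, `|\sum_(n < N.+1) c n| <= M)
  /\
  (* (ii) *)
  ((0 <= limn_einf (fun n => (c n)%:E))%E ->
   forall F1 : Cx R,
   pseudofunction_bb (fun z : Cx R => (psum c z - F1) / (z - 1)) 0 ->
   series (fun n => ((c n)%:C%C : Cx R)) @ \oo --> F1).
Proof.
move=> c_cvg.
(* Localization at angle 0: the radius e found there fixes the width of the kernel, and one [G]
   serves every modulation N. *)
have local (P : (R -> Cx R) -> Prop) F1 :
    boundary_behavior P (fun z : Cx R => (psum c z - F1) / (z - 1)) 0 ->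
    exists e phi w, [/\ 0 < e, positive_kernel e phi w & exists T G, P G /\
      (forall N, - complex.Re (smeared phi c F1 N r : R[i]) @[r --> (1 : R)^'-] -->
          - complex.Re (T (modulation phi N) : R[i]) /\
        - complex.Im (smeared phi c F1 N r : R[i]) @[r --> (1 : R)^'-] -->
          - complex.Im (T (modulation phi N) : R[i])) /\
      forall N, T (modulation phi N) = inv_fourier_action G (modulation phi N)].
  move=> [a [b [ab [T [HT /(_ 0 ab)[e [e0 [ae [eb [G [PG HG]]]]]]]]]]].
  rewrite sub0r in ae; rewrite add0r in eb.
  have [phi [w K]] := positive_kernel_exists e0.
  exists e, phi, w; split => //; exists T, G; split => //; split.
    apply: (smeared_cvg_action e0 K) => f [s1 [s2 [a' [b' [ha [hb hf]]]]]].
    apply: HT; split => //; split => //; exists a', b'.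
    by split; [exact: le_lt_trans ha|split; [exact: lt_le_trans eb|]].
  by move=> N; apply: HG; rewrite sub0r add0r; exact: (test_fun_modulation e0 K).
have Re_incr F1 n : complex.Re (remainder c F1 n.+2 : R[i]) -
    complex.Re (remainder c F1 n.+1 : R[i]) = c n.+1.
  by rewrite /remainder !Re_add !Re_opp /= big_ord_recr /=; ring.
split.
- move=> [m Hm] H.
  have : boundary_behavior Linf_fun (fun z : Cx R => (psum c z - 0) / (z - 1)) 0.
    rewrite (_ : (fun z => _) = fun z : Cx R => psum c z / (z - 1)) //.
    by apply/funext => z; rewrite subr0.
  move=> /local[e [phi [w [e0 K [T [G [PG [HT HTG]]]]]]]].
  have [W HW] := kernel_sum_bounded K.
  have [b Hb] := action_bounded K PG.
  (* The given lower bound may be positive, whereas the sequence argument takes increments above -m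
     with m >= 0. *)
  have m0 : 0 <= Num.max 0 (- m) by rewrite le_max lexx.
  have incr n : - Num.max 0 (- m) <= complex.Re (remainder c 0 n.+2 : R[i]) -
      complex.Re (remainder c 0 n.+1 : R[i]).
    by rewrite Re_incr (le_trans _ (Hm _)) // lerNl le_max lexx orbT.
  have beta_le N : `|- complex.Re (T (modulation phi N) : R[i])| <= b.
    by rewrite normrN HTG.
  have [M HM] := tauberian_bounded (pk_ge0 K) (pk_gt0 K) HW
    (fun N r r01 => (smeared_series K c_cvg 0 N r01).1) (fun N => (HT N).1) m0 incr beta_le.
  exists M => N; have := HM N; rewrite /remainder Re_add Re_opp /= subr0; exact.
- move=> /limn_einf_ge0 Hc F1 /local[e [phi [w [e0 K [T [G [PG [HT HTG]]]]]]]].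
  have [W HW] := kernel_sum_bounded K.
  have [R0 I0] := action_cvg0 K PG.
  (* The inferior limit bounds c_n below by -1 from n0 on; the sum of the finitely many earlier
     |c_k| covers the rest. *)
  have [m m0 Hm] : exists2 m, 0 <= m & forall n, - m <= c n.
    have [n0 _ Hn0] := Hc 1 ltr01.
    exists (1 + \sum_(k < n0) `|c k|) => [|n]; first by rewrite addr_ge0 // sumr_ge0.
    have S0 : 0 <= \sum_(k < n0) `|c k| by rewrite sumr_ge0.
    have [nn|nn] := leqP n0 n; first by have := Hn0 n nn; rewrite /=; lra.
    have : `|c n| <= \sum_(k < n0) `|c k|.
      by rewrite (bigD1 (Ordinal nn)) //= lerDl sumr_ge0.
    by rewrite ler_norml; lra.
  have beta0 (f : nat -> R) : f @ \oo --> (0 : R) -> (fun N => - f N) @ \oo --> (0 : R).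
    by move=> h; have := cvgN h; rewrite oppr0; exact.
  have Recvg : (fun n => complex.Re (remainder c F1 n.+1 : R[i])) @ \oo --> (0 : R).
    apply: (tauberian_cvg0 (pk_ge0 K) (pk_gt0 K) HW
      (fun N r r01 => (smeared_series K c_cvg F1 N r01).1) (fun N => (HT N).1) m0).
    + by move=> n; rewrite Re_incr.
    + by apply: beta0; under eq_fun do rewrite HTG.
    + move=> d d0; have [n1 _ Hn1] := Hc d d0; exists n1 => // n /= hn.
      by rewrite Re_incr; apply: Hn1 => /=; exact: leqW.
  (* The imaginary part of the remainder is the constant -Im F(1). With zero increments the same
     argument, at m = 0, makes it tend to 0, so F(1) is real. *)
  have Imcvg : (fun n => complex.Im (remainder c F1 n.+1 : R[i])) @ \oo --> (0 : R).
    have Im_incr n : complex.Im (remainder c F1 n.+2 : R[i]) -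
        complex.Im (remainder c F1 n.+1 : R[i]) = 0.
      by rewrite /remainder !Im_add !Im_opp /= subrr.
    apply: (tauberian_cvg0 (pk_ge0 K) (pk_gt0 K) HW
      (fun N r r01 => (smeared_series K c_cvg F1 N r01).2) (fun N => (HT N).2) (lexx 0)).
    + by move=> n; rewrite Im_incr oppr0.
    + by apply: beta0; under eq_fun do rewrite HTG.
    + by move=> d d0; apply: nearW => n; rewrite Im_incr oppr_le0 ltW.
  have rem0 : (fun n => remainder c F1 n.+1) @ \oo --> (0 : Cx R).
    exact: cvg_complex_of_ReIm.
  pose u : nat -> Cx R := series (fun n => ((c n)%:C%C : Cx R)).
  have uE : (fun n => u n.+1) = fun n => remainder c F1 n.+1 + F1.
    apply/funext => n; rewrite /remainder subrK /u /series /= big_mkord.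
    by rewrite (big_morph _ (fun x y => rmorphD (real_complex R) x y) (erefl _)).
  have L : (fun n => u n.+1) @ \oo --> (0 + F1 : Cx R).
    by rewrite uE; exact: (cvgD rem0 (cvg_cst F1)).
  rewrite add0r in L.
  by rewrite -/u -(cvg_shiftS u); exact: L.
Qed.
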